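(* Let $R$ be a noetherian ring and let $n \in \mathbb{Z}_{\geq 0}$. Then the induced morphism $f : \operatorname{Spec} R(t_1, \ldots, t_n) \to \operatorname{Spec} R$ is a strongly $\mathbb{A}^n$-localising surjective morphism. In particular, $f$ is essentially smooth and faithfully flat.
   Context: For a ring $R$, let $U := \bigcap_{\mathfrak p \in \operatorname{Spec} R} (R[t_1,\ldots,t_n] \setminus \mathfrak p R[t_1,\ldots,t_n])$, a multiplicatively closed subset of the polynomial ring, and $R(t_1,\ldots,t_n) := U^{-1}R[t_1,\ldots,t_n]$. A ring homomorphism $A \to B$ is $\mathbb{A}^n$-localising if $B$ is isomorphic as an $A$-algebra to $S^{-1}(A[x_1,\ldots,x_n])$ for some multiplicatively closed subset $S$ of the polynomial ring $A[x_1,\ldots,x_n]$. A morphism $f : X \to Y$ of schemes is strongly $\mathbb{A}^n$-localising if $f$ is affine and for every affine open subset $Y'$ of $Y$ the induced ring homomorphism $\mathcal{O}_Y(Y') \to \mathcal{O}_X(f^{-1}(Y'))$ is $\mathbb{A}^n$-localising. Essentially smooth means: given by a localisation of a smooth algebra. *)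

(* Defs.v *)
From HB Require Import structures.
From mathcomp Require Import all_boot all_algebra.
From mathcomp Require Import boolp classical_sets topology_structure.
From mathcomp Require Import ring.

Set Implicit Arguments.
Unset Strict Implicit.
Unset Printing Implicit Defensive.

Import GRing.Theory.
Local Open Scope classical_set_scope.
Local Open Scope ring_scope.

(* Throughout, rings are commutative and possibly zero (comPzRingType): the
   ring of sections of a structure sheaf over the empty set is zero. *)

Record preRing := PreRing {
  pr_car :> Type;
  pr_eq : pr_car -> pr_car -> Prop;
  pr_zero : pr_car;
  pr_one : pr_car;
  pr_opp : pr_car -> pr_car;
  pr_add : pr_car -> pr_car -> pr_car;
  pr_mul : pr_car -> pr_car -> pr_car;
  pr_refl : forall x, pr_eq x x;
  pr_sym : forall x y, pr_eq x y -> pr_eq y x;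
  pr_trans : forall x y z, pr_eq x y -> pr_eq y z -> pr_eq x z;
  pr_oppE : forall x x', pr_eq x x' -> pr_eq (pr_opp x) (pr_opp x');
  pr_addE : forall x x' y y', pr_eq x x' -> pr_eq y y' ->
    pr_eq (pr_add x y) (pr_add x' y');
  pr_mulE : forall x x' y y', pr_eq x x' -> pr_eq y y' ->
    pr_eq (pr_mul x y) (pr_mul x' y');
  pr_addA : forall x y z,
    pr_eq (pr_add x (pr_add y z)) (pr_add (pr_add x y) z);
  pr_addC : forall x y, pr_eq (pr_add x y) (pr_add y x);
  pr_add0 : forall x, pr_eq (pr_add pr_zero x) x;
  pr_addN : forall x, pr_eq (pr_add (pr_opp x) x) pr_zero;
  pr_mulA : forall x y z,
    pr_eq (pr_mul x (pr_mul y z)) (pr_mul (pr_mul x y) z);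
  pr_mulC : forall x y, pr_eq (pr_mul x y) (pr_mul y x);
  pr_mul1 : forall x, pr_eq (pr_mul pr_one x) x;
  pr_mulD : forall x y z,
    pr_eq (pr_mul (pr_add x y) z) (pr_add (pr_mul x z) (pr_mul y z))
}.

Section PreRingQuotient.
Variable P : preRing.

Definition pr_quot : Type := {C : set P | exists x, C = pr_eq x}.

HB.instance Definition _ := gen_eqMixin pr_quot.
HB.instance Definition _ := gen_choiceMixin pr_quot.

Definition pr_pi (x : P) : pr_quot := exist _ (pr_eq x) (ex_intro _ x erefl).
Definition pr_repr (c : pr_quot) : P := projT1 (cid (proj2_sig c)).

Lemma pr_quot_ext (c d : pr_quot) : proj1_sig c = proj1_sig d -> c = d.
Proof.
case: c d => [C hC] [D hD] /= e; subst D.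
by congr exist; apply: Prop_irrelevance.
Qed.

Lemma pr_reprK c : pr_pi (pr_repr c) = c.
Proof. by apply: pr_quot_ext; rewrite /pr_repr /=; case: (cid _). Qed.

Lemma pr_pi_eq x y : pr_eq x y -> pr_pi x = pr_pi y.
Proof.
move=> xy; apply: pr_quot_ext; apply/funext => z; apply/propext.
split=> h; last exact: pr_trans xy h.
exact: pr_trans (pr_sym xy) h.
Qed.

Lemma pr_pi_inj x y : pr_pi x = pr_pi y -> pr_eq x y.
Proof. by move=> /(congr1 (@proj1_sig _ _)) /= ->; apply: pr_refl. Qed.

Lemma pr_repr_pi x : pr_eq (pr_repr (pr_pi x)) x.
Proof. by apply: pr_pi_inj; rewrite pr_reprK. Qed.

Lemma pr_quotP (Q : pr_quot -> Prop) : (forall x, Q (pr_pi x)) -> forall c, Q c.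
Proof. by move=> h c; rewrite -(pr_reprK c). Qed.

Definition prq_opp c := pr_pi (pr_opp (pr_repr c)).
Definition prq_add c d := pr_pi (pr_add (pr_repr c) (pr_repr d)).
Definition prq_mul c d := pr_pi (pr_mul (pr_repr c) (pr_repr d)).

Lemma prq_oppE x : prq_opp (pr_pi x) = pr_pi (pr_opp x).
Proof. by apply: pr_pi_eq; apply: pr_oppE; apply: pr_repr_pi. Qed.

Lemma prq_addE x y : prq_add (pr_pi x) (pr_pi y) = pr_pi (pr_add x y).
Proof. by apply: pr_pi_eq; apply: pr_addE; apply: pr_repr_pi. Qed.

Lemma prq_mulE x y : prq_mul (pr_pi x) (pr_pi y) = pr_pi (pr_mul x y).
Proof. by apply: pr_pi_eq; apply: pr_mulE; apply: pr_repr_pi. Qed.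

Fact prq_addA : associative prq_add.
Proof.
elim/pr_quotP=> x; elim/pr_quotP=> y; elim/pr_quotP=> z.
by rewrite !prq_addE; apply: pr_pi_eq; apply: pr_addA.
Qed.

Fact prq_addC : commutative prq_add.
Proof.
elim/pr_quotP=> x; elim/pr_quotP=> y.
by rewrite !prq_addE; apply: pr_pi_eq; apply: pr_addC.
Qed.

Fact prq_add0 : left_id (pr_pi (pr_zero P)) prq_add.
Proof.
by elim/pr_quotP=> x; rewrite prq_addE; apply: pr_pi_eq; apply: pr_add0.
Qed.

Fact prq_addN : left_inverse (pr_pi (pr_zero P)) prq_opp prq_add.
Proof.
elim/pr_quotP=> x; rewrite prq_oppE prq_addE.
by apply: pr_pi_eq; apply: pr_addN.
Qed.

HB.instance Definition _ :=
  GRing.isZmodule.Build pr_quot prq_addA prq_addC prq_add0 prq_addN.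

Fact prq_mulA : associative prq_mul.
Proof.
elim/pr_quotP=> x; elim/pr_quotP=> y; elim/pr_quotP=> z.
by rewrite !prq_mulE; apply: pr_pi_eq; apply: pr_mulA.
Qed.

Fact prq_mulC : commutative prq_mul.
Proof.
elim/pr_quotP=> x; elim/pr_quotP=> y.
by rewrite !prq_mulE; apply: pr_pi_eq; apply: pr_mulC.
Qed.

Fact prq_mul1 : left_id (pr_pi (pr_one P)) prq_mul.
Proof.
by elim/pr_quotP=> x; rewrite prq_mulE; apply: pr_pi_eq; apply: pr_mul1.
Qed.

Fact prq_mulD : left_distributive prq_mul prq_add.
Proof.
elim/pr_quotP=> x; elim/pr_quotP=> y; elim/pr_quotP=> z.
by rewrite !(prq_mulE, prq_addE); apply: pr_pi_eq; apply: pr_mulD.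
Qed.

HB.instance Definition _ :=
  GRing.Zmodule_isComPzRing.Build pr_quot prq_mulA prq_mulC prq_mul1 prq_mulD.

End PreRingQuotient.

Section Ideals.
Variable A : comPzRingType.

Definition ideal (I : set A) : Prop :=
  [/\ I 0, forall x y, I x -> I y -> I (x + y)
    & forall a x, I x -> I (a * x)].

Definition ideal_gen (E : set A) : set A :=
  [set x | forall I : set A, ideal I -> E `<=` I -> I x].

Definition noetherian : Prop :=
  forall I : set A, ideal I -> exists l : seq A, I = ideal_gen [set` l].

Record spec : Type := SpecPoint {
  sp_set :> A -> Prop;
  sp_ideal : ideal sp_set;
  sp_proper : ~ sp_set 1;
  sp_prime : forall x y, sp_set (x * y) -> sp_set x \/ sp_set y
}.

Record mulset : Type := MulSet {
  ms_set :> A -> Prop;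
  ms_one : ms_set 1;
  ms_mul : forall x y, ms_set x -> ms_set y -> ms_set (x * y)
}.

Lemma sp_ext (p q : spec) : (forall x, p x <-> q x) -> p = q.
Proof.
move=> pq; have e : sp_set p = sp_set q.
  by apply/funext => x; apply/propext; apply: pq.
case: p q {pq} e => [p ? ? ?] [q ? ? ?] /= e; subst q.
by congr SpecPoint; apply: Prop_irrelevance.
Qed.

Lemma idealN (I : set A) x : ideal I -> I x -> I (- x).
Proof. by case=> _ _ h /(h (-1)); rewrite mulN1r. Qed.

Lemma idealMr (I : set A) x a : ideal I -> I x -> I (x * a).
Proof. by case=> _ _ h /(h a); rewrite mulrC. Qed.

Lemma ideal_sum (I : set A) (J : Type) (r : seq J) (Q : pred J) F :
  ideal I -> (forall i, Q i -> I (F i)) -> I (\sum_(i <- r | Q i) F i).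
Proof. by case=> h0 hD _ h; apply: big_ind. Qed.

Lemma ideal_gen_ideal E : ideal (ideal_gen E).
Proof.
split=> [I [] //|x y hx hy I iI EI|a x hx I iI EI]; case: (iI) => _ hD hM.
  by apply: hD; [apply: hx | apply: hy].
by apply: hM; apply: hx.
Qed.

Lemma ideal_gen_min E I : ideal I -> E `<=` I -> ideal_gen E `<=` I.
Proof. by move=> iI EI x; apply. Qed.

Lemma ideal_gen_sub E : E `<=` ideal_gen E.
Proof. by move=> x Ex I _; apply. Qed.

Definition sp_compl (p : spec) : mulset.
Proof.
exists (~` sp_set p); first exact: sp_proper.
by move=> x y px py /sp_prime[].
Defined.

End Ideals.

HB.instance Definition _ A := gen_eqMixin (spec A).
HB.instance Definition _ A := gen_choiceMixin (spec A).

Section Localisation.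
Variables (A : comPzRingType) (S : mulset A).

Record fraction : Type := Fraction {
  fr_num : A;
  fr_den : A;
  fr_denP : S fr_den
}.

Definition fr_eq (x y : fraction) : Prop := exists2 u, S u &
  u * (fr_num x * fr_den y) = u * (fr_num y * fr_den x).

Fact fr_refl x : fr_eq x x.
Proof. by exists 1 => //; apply: ms_one. Qed.

Fact fr_sym x y : fr_eq x y -> fr_eq y x.
Proof. by case=> u Su e; exists u. Qed.

Fact fr_trans x y z : fr_eq x y -> fr_eq y z -> fr_eq x z.
Proof.
move=> [u Su e] [v Sv f]; exists (u * v * fr_den y).
  by apply: ms_mul; [apply: ms_mul | apply: fr_denP].
transitivity (v * fr_den z * (u * (fr_num x * fr_den y))); first by ring.
rewrite e; transitivity (u * fr_den x * (v * (fr_num y * fr_den z))).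
  by ring.
by rewrite f; ring.
Qed.

Definition fr_opp x := Fraction (- fr_num x) (fr_denP x).
Definition fr_add x y :=
  Fraction (fr_num x * fr_den y + fr_num y * fr_den x)
    (ms_mul (fr_denP x) (fr_denP y)).
Definition fr_mul x y :=
  Fraction (fr_num x * fr_num y) (ms_mul (fr_denP x) (fr_denP y)).

Fact fr_oppE x x' : fr_eq x x' -> fr_eq (fr_opp x) (fr_opp x').
Proof. by case=> u Su e; exists u => //=; rewrite !mulNr !mulrN e. Qed.

Fact fr_addE x x' y y' : fr_eq x x' -> fr_eq y y' ->
  fr_eq (fr_add x y) (fr_add x' y').
Proof.
case=> u Su e [v Sv f]; exists (u * v) => /=; first exact: ms_mul.
transitivity (v * fr_den y * fr_den y' * (u * (fr_num x * fr_den x'))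
  + u * fr_den x * fr_den x' * (v * (fr_num y * fr_den y'))); first by ring.
by rewrite e f; ring.
Qed.

Fact fr_mulE x x' y y' : fr_eq x x' -> fr_eq y y' ->
  fr_eq (fr_mul x y) (fr_mul x' y').
Proof.
case=> u Su e [v Sv f]; exists (u * v) => /=; first exact: ms_mul.
transitivity (u * (fr_num x * fr_den x') * (v * (fr_num y * fr_den y'))).
  by ring.
by rewrite e f; ring.
Qed.

Definition fr_preRing : preRing.
Proof.
apply: (@PreRing fraction fr_eq (Fraction 0 (ms_one S)) (Fraction 1 (ms_one S))
  fr_opp fr_add fr_mul fr_refl fr_sym fr_trans fr_oppE fr_addE fr_mulE);
  abstract (by move=> *; exists 1; [exact: ms_one | rewrite /=; ring]).
Defined.

Definition loc : comPzRingType := pr_quot fr_preRing.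

Definition frac (a s : A) (Ss : S s) : loc := pr_pi (P := fr_preRing) (Fraction a Ss).

Lemma frac_eq a s (Ss : S s) b t (St : S t) :
  frac a Ss = frac b St <-> exists2 u, S u & u * (a * t) = u * (b * s).
Proof. by split=> [/(pr_pi_inj (P := fr_preRing))|h]; last exact: pr_pi_eq. Qed.

Lemma locP (Q : loc -> Prop) :
  (forall a s (Ss : S s), Q (frac a Ss)) -> forall x, Q x.
Proof. by move=> h; apply: pr_quotP => -[a s Ss]; apply: h. Qed.

Lemma fracD a s (Ss : S s) b t (St : S t) :
  frac a Ss + frac b St = frac (a * t + b * s) (ms_mul Ss St).
Proof. exact: prq_addE. Qed.

Lemma fracN a s (Ss : S s) : - frac a Ss = frac (- a) Ss.
Proof. exact: prq_oppE. Qed.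

Lemma fracM a s (Ss : S s) b t (St : S t) :
  frac a Ss * frac b St = frac (a * b) (ms_mul Ss St).
Proof. exact: prq_mulE. Qed.

Lemma frac1 : frac 1 (ms_one S) = 1.
Proof. by []. Qed.

Definition to_loc (a : A) : loc := frac a (ms_one S).

Fact to_loc_zmod : zmod_morphism to_loc.
Proof.
move=> a b; rewrite /to_loc fracN fracD; apply/frac_eq.
by exists 1; [exact: ms_one | ring].
Qed.

Fact to_loc_monoid : monoid_morphism to_loc.
Proof.
split=> // a b; rewrite /to_loc fracM; apply/frac_eq.
by exists 1; [exact: ms_one | ring].
Qed.

HB.instance Definition _ := GRing.isZmodMorphism.Build A loc to_loc to_loc_zmod.
HB.instance Definition _ :=
  GRing.isMonoidMorphism.Build A loc to_loc to_loc_monoid.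

End Localisation.

Section LocMap.
Variables (A B : comPzRingType) (phi : {rmorphism A -> B}).
Variables (S : mulset A) (T : mulset B) (ST : forall s, S s -> T (phi s)).

Definition loc_map (x : loc S) : loc T :=
  let f : fraction S := pr_repr x in frac (phi (fr_num f)) (ST (fr_denP f)).

Lemma loc_mapE a s (Ss : S s) : loc_map (frac a Ss) = frac (phi a) (ST Ss).
Proof.
rewrite /loc_map /frac; apply: (@pr_pi_eq (fr_preRing T)).
have [u Su e] := pr_repr_pi (P := fr_preRing S) (Fraction a Ss).
by exists (phi u); [exact: ST | move: e => /= e; rewrite -!rmorphM e].
Qed.

Fact loc_map_zmod : zmod_morphism loc_map.
Proof.
elim/locP=> a s Ss; elim/locP=> b t St.
rewrite fracN fracD !loc_mapE fracN fracD; apply/frac_eq; exists 1; first exact: ms_one.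
by rewrite !(rmorphD, rmorphN, rmorphM).
Qed.

Fact loc_map_monoid : monoid_morphism loc_map.
Proof.
split=> [|].
  rewrite -(frac1 S) loc_mapE; apply/frac_eq; exists 1; first exact: ms_one.
  by rewrite rmorph1.
elim/locP=> a s Ss; elim/locP=> b t St.
rewrite fracM !loc_mapE fracM; apply/frac_eq; exists 1; first exact: ms_one.
by rewrite !rmorphM.
Qed.

HB.instance Definition _ :=
  GRing.isZmodMorphism.Build (loc S) (loc T) loc_map loc_map_zmod.
HB.instance Definition _ :=
  GRing.isMonoidMorphism.Build (loc S) (loc T) loc_map loc_map_monoid.

End LocMap.

Section SpecMap.
Variables (A B : comPzRingType) (phi : {rmorphism A -> B}).

Definition spec_map (q : spec B) : spec A.
Proof.
exists (phi @^-1` sp_set q).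
- have [h0 hD hM] := sp_ideal q; split=> [|x y|a x] /=.
  + by rewrite rmorph0.
  + by rewrite rmorphD; apply: hD.
  + by rewrite rmorphM; apply: hM.
- by rewrite /= rmorph1; apply: sp_proper.
- by move=> x y /=; rewrite rmorphM => /sp_prime.
Defined.

Definition loc_at_map (q : spec B) :
    {rmorphism loc (sp_compl (spec_map q)) -> loc (sp_compl q)} :=
  @loc_map A B phi (sp_compl (spec_map q)) (sp_compl q) (fun s h => h).

End SpecMap.

(* {poly A} requires A to be non-zero, hence this version. *)
Section Poly1.
Variable A : comPzRingType.

Record poly1 : Type := Poly1 {
  p1_coef :> nat -> A;
  p1_fin : exists N, forall i, (N <= i)%N -> p1_coef i = 0
}.

HB.instance Definition _ := gen_eqMixin poly1.
HB.instance Definition _ := gen_choiceMixin poly1.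

Lemma p1_ext (f g : poly1) : (forall i, f i = g i) -> f = g.
Proof.
case: f g => [f hf] [g hg] /= /funext e; subst g.
by congr Poly1; apply: Prop_irrelevance.
Qed.

Definition p1_const (a : A) : poly1.
Proof. by exists (fun i => if i == 0%N then a else 0); exists 1%N; case. Defined.

Definition p1_opp (f : poly1) : poly1.
Proof.
exists (fun i => - f i).
by have [N hN] := p1_fin f; exists N => i /hN ->; rewrite oppr0.
Defined.

Definition p1_add (f g : poly1) : poly1.
Proof.
exists (fun i => f i + g i).
have [N hN] := p1_fin f; have [M hM] := p1_fin g.
exists (maxn N M) => i; rewrite geq_max => /andP[/hN-> /hM->].
by rewrite addr0.
Defined.

Definition p1_mul (f g : poly1) : poly1.
Proof.
exists (fun i => \sum_(j < i.+1) f j * g (i - j)%N).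
have [N hN] := p1_fin f; have [M hM] := p1_fin g.
exists (N + M)%N => i hi; apply: big1 => j _.
have [/hN ->|jN] := leqP N j; first by rewrite mul0r.
rewrite hM ?mulr0 // leq_subRL; last by rewrite -ltnS.
by apply: leq_trans hi; rewrite leq_add2r ltnW.
Defined.

Fact p1_addA : associative p1_add.
Proof. by move=> f g h; apply: p1_ext => i /=; rewrite addrA. Qed.

Fact p1_addC : commutative p1_add.
Proof. by move=> f g; apply: p1_ext => i /=; rewrite addrC. Qed.

Fact p1_add0 : left_id (p1_const 0) p1_add.
Proof. by move=> f; apply: p1_ext => i /=; rewrite if_same add0r. Qed.

Fact p1_addN : left_inverse (p1_const 0) p1_opp p1_add.
Proof. by move=> f; apply: p1_ext => i /=; rewrite if_same addNr. Qed.

HB.instance Definition _ :=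
  GRing.isZmodule.Build poly1 p1_addA p1_addC p1_add0 p1_addN.

Lemma p1_coefM_rev f g i :
  p1_mul f g i = \sum_(j < i.+1) f (i - j)%N * g j.
Proof.
rewrite /= (reindex_inj rev_ord_inj) /=.
by apply: eq_bigr => j _; rewrite (sub_ordK j).
Qed.

Fact p1_mulC : commutative p1_mul.
Proof.
move=> f g; apply: p1_ext => i; rewrite p1_coefM_rev /=.
by apply: eq_bigr => j _; rewrite mulrC.
Qed.

Fact p1_mulA : associative p1_mul.
Proof.
move=> p q r; apply: p1_ext => i; rewrite [LHS]/= p1_coefM_rev.
pose coef3 j k := p j * (q (i - j - k)%N * r k).
transitivity (\sum_(j < i.+1) \sum_(k < i.+1 | (k <= i - j)%N) coef3 j k).
  apply: eq_bigr => /= j _; rewrite -[X in _ * X]/(p1_mul q r (i - j)%N).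
  rewrite p1_coefM_rev big_distrr /=.
  by rewrite (big_ord_narrow_leq (leq_subr _ _)).
rewrite (exchange_big_dep predT) //=; apply: eq_bigr => k _.
transitivity (\sum_(j < i.+1 | (j <= i - k)%N) coef3 j k).
  apply: eq_bigl => j; rewrite -ltnS -(ltnS j) -!subSn ?leq_ord //.
  by rewrite -subn_gt0 -(subn_gt0 j) -!subnDA addnC.
rewrite (big_ord_narrow_leq (leq_subr _ _)) big_distrl /=.
by apply: eq_bigr => j _; rewrite /coef3 -!subnDA addnC mulrA.
Qed.

Fact p1_mul1 : left_id (p1_const 1) p1_mul.
Proof.
move=> p; apply: p1_ext => i /=; rewrite big_ord_recl subn0 /= mul1r.
by rewrite big1 ?addr0 // => j _; rewrite mul0r.
Qed.

Fact p1_mulD : left_distributive p1_mul p1_add.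
Proof.
move=> p q r; apply: p1_ext => i /=; rewrite -big_split.
by apply: eq_bigr => j _; rewrite mulrDl.
Qed.

HB.instance Definition _ :=
  GRing.Zmodule_isComPzRing.Build poly1 p1_mulA p1_mulC p1_mul1 p1_mulD.

Fact p1_const_zmod : zmod_morphism p1_const.
Proof. by move=> a b; apply: p1_ext => -[|i] //=; rewrite subr0. Qed.

Fact p1_const_monoid : monoid_morphism p1_const.
Proof.
split=> // a b; apply: p1_ext => i /=; rewrite big_ord_recl subn0 /=.
rewrite big1 ?addr0 => [|j _]; last by rewrite mul0r.
by case: (i == 0%N); rewrite ?mulr0.
Qed.

HB.instance Definition _ :=
  GRing.isZmodMorphism.Build A poly1 p1_const p1_const_zmod.
HB.instance Definition _ :=
  GRing.isMonoidMorphism.Build A poly1 p1_const p1_const_monoid.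

End Poly1.

(* A[x_1, ..., x_n] as A[x_1, ..., x_(n-1)][x_n] *)
Fixpoint polyn (n : nat) (A : comPzRingType) : comPzRingType :=
  if n is m.+1 then poly1 (polyn m A) else A.

Fixpoint polyC (n : nat) (A : comPzRingType) : {rmorphism A -> polyn n A} :=
  match n return {rmorphism A -> polyn n A} with
  | 0%N => idfun
  | m.+1 => @p1_const (polyn m A) \o polyC m A
  end.

Definition ideal_polyn n (A : comPzRingType) (I : set A) : set (polyn n A) :=
  ideal_gen (polyC n A @` I).
Arguments ideal_polyn n {A} I _.

Section PrimeExtension.

Lemma p1_const_mulE (A : comPzRingType) (a : A) (f : poly1 A) i :
  (p1_const a * f) i = a * f i.
Proof.
rewrite /GRing.mul /= big_ord_recl subn0 big1 ?addr0 //.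
by move=> j _; rewrite mul0r.
Qed.

Definition p1_mono (A : comPzRingType) (N : nat) : poly1 A.
Proof.
by exists (fun i => if i == N then 1 else 0); exists N.+1 => i; case: ltngtP.
Defined.

Lemma ideal_p1P (A : comPzRingType) (I : set A) (f : poly1 A) : ideal I ->
  ideal_gen (@p1_const A @` I) f <-> forall i, I (f i).
Proof.
move=> iI; have [h0 hD hM] := iI; split=> [|If].
  apply: (@ideal_gen_min _ _ [set g : poly1 A | forall i, I (g i)]).
    split=> [i|g h Ig Ih i|g h Ih i] /=; first by rewrite if_same.
      exact: hD.
    by apply: ideal_sum => // j _; apply: hM.
  by move=> _ [a Ia <-] i /=; case: ifP.
have [N] := p1_fin f; elim: N f If => [|N IH] f If hf.
  have -> : f = 0 by apply: p1_ext => i; rewrite hf //= if_same.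
  by case: (ideal_gen_ideal (@p1_const A @` I)).
have [_ gD gM] := ideal_gen_ideal (@p1_const A @` I).
pose m := p1_const (f N) * p1_mono A N.
have mE i : m i = if i == N then f N else 0.
  by rewrite p1_const_mulE /=; case: ifP; rewrite ?mulr1 ?mulr0.
have -> : f = (f - m) + m by rewrite subrK.
apply: gD.
  have fmE i : (f - m) i = if i == N then 0 else f i.
    rewrite -[LHS]/(f i - m i) mE; case: eqP => [->|_]; first by rewrite subrr.
    by rewrite subr0.
  apply: IH => i; rewrite fmE; case: ifP => //.
  by move=> /negbT iN Ni; apply: hf; rewrite ltn_neqAle eq_sym iN.
by rewrite /m mulrC; apply: gM; apply: ideal_gen_sub; exists (f N).
Qed.

Lemma p1_prime (A : comPzRingType) (p : spec A) (f g : poly1 A) :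
  (forall i, p ((f * g) i)) -> (forall i, p (f i)) \/ (forall i, p (g i)).
Proof.
move=> pfg; have ip := sp_ideal p; apply: contrapT => /not_orP[].
move=> /existsNP[i0 hi0] /existsNP[j0 hj0].
have exf : exists i, `[< ~ p (f i) >] by exists i0; apply/asboolP.
have exg : exists j, `[< ~ p (g j) >] by exists j0; apply/asboolP.
case: (ex_minnP exf) => i /asboolP fi mini.
case: (ex_minnP exg) => j /asboolP gj minj.
have pf k : (k < i)%N -> p (f k).
  by apply: contraPP => /asboolP/mini; rewrite leqNgt => /negP.
have pg k : (k < j)%N -> p (g k).
  by apply: contraPP => /asboolP/minj; rewrite leqNgt => /negP.
have lti : (i < (i + j).+1)%N by rewrite ltnS leq_addr.
have := pfg (i + j)%N; rewrite {1}/GRing.mul /= (bigD1 (Ordinal lti)) //=.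
set s := \sum_(_ < _ | _) _ => h.
have ps : p s.
  apply: ideal_sum => // -[k ltk] /= /eqP nk.
  have [ki|ik|kie] := ltngtP k i.
  - by apply: idealMr => //; apply: pf.
  - case: (ip) => _ _; apply; apply: pg.
    by rewrite ltn_subLR // ltn_add2r.
  - by case: nk; apply: val_inj.
have : p (f i * g j).
  rewrite -(addrK s (f i * g j)); case: (ip) => _ hD _.
  apply: hD; last exact: idealN.
  by move: h; rewrite addKn.
by case/sp_prime.
Qed.

Lemma ideal_polynS n (A : comPzRingType) (I : set A) :
  ideal_polyn n.+1 I = ideal_gen (@p1_const (polyn n A) @` ideal_polyn n I).
Proof.
apply/seteqP; split=> f hf J iJ sJ; apply: hf => // _ [a Ia <-].
  by apply: sJ; exists (polyC n A a) => //; apply: ideal_gen_sub; exists a.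
have [J0 JD JM] := iJ.
apply: (Ia (@p1_const _ @^-1` J)) => [|_ [b Ib <-]]; last by apply: sJ; exists b.
split=> [|x y|x y] /=; first by rewrite rmorph0.
  by rewrite rmorphD; apply: JD.
by rewrite rmorphM; apply: JM.
Qed.

Lemma ideal_polyn_prime n (A : comPzRingType) (p : spec A) :
  exists q : spec (polyn n A), sp_set q = ideal_polyn n p.
Proof.
elim: n => [|n [q qE]].
  exists p; apply/seteqP; split=> x; first by move=> px; apply: ideal_gen_sub; exists x.
  by apply; [exact: sp_ideal | move=> _ [y py <-]].
pose I := ideal_polyn n.+1 (sp_set p).
have IE f : I f <-> forall i, q (f i).
  rewrite /I ideal_polynS -qE; exact/ideal_p1P/sp_ideal.
have iI : ideal I by exact: ideal_gen_ideal.
have nI : ~ I 1 by move/IE/(_ 0%N); apply: sp_proper.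
have pI x y : I (x * y) -> I x \/ I y by rewrite !IE; apply: p1_prime.
by exists (SpecPoint iI nI pI).
Qed.

End PrimeExtension.

(* The multiplicative set U of the polynomials outside every p R[t]. *)
Definition gauss_mulset n (R : comPzRingType) : mulset (polyn n R).
Proof.
exists [set f | forall p : spec R, ~ ideal_polyn n p f].
- by move=> p; have [q <-] := ideal_polyn_prime n p; apply: sp_proper.
- move=> f g hf hg p; move: (hf p) (hg p).
  by have [q <-] := ideal_polyn_prime n p => ? ? /sp_prime[].
Defined.

(* R(t_1, ..., t_n) *)
Definition gauss n (R : comPzRingType) : comPzRingType := loc (gauss_mulset n R).

Definition to_gauss n (R : comPzRingType) : {rmorphism R -> gauss n R} :=
  @to_loc (polyn n R) (gauss_mulset n R) \o polyC n R.

Section RingHom.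
Variables (A B : comPzRingType) (phi : {rmorphism A -> B}).

(* B is isomorphic to S^-1 C as an A-algebra, for an A-algebra C. *)
Definition is_localisation_of (C : comPzRingType) (psi : {rmorphism A -> C}) :=
  exists (S : mulset C) (e : {rmorphism loc S -> B}),
    bijective e /\ forall a, e (to_loc S (psi a)) = phi a.

Definition An_localising (n : nat) : Prop := is_localisation_of (polyC n A).

Definition finitely_presented : Prop :=
  exists (m : nat) (e : {rmorphism polyn m A -> B}) (l : seq (polyn m A)),
    [/\ forall a, e (polyC m A a) = phi a,
        forall b, exists f, e f = b
      & forall f, e f = 0 <-> ideal_gen [set` l] f].

(* Infinitesimal lifting: every A-algebra map B -> D lifts along any surjection
   C -> D of A-algebras (with structure map iota : A -> C) whose kernel squares
   to zero. *)
Definition formally_smooth : Prop :=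
  forall (C D : comPzRingType) (iota : {rmorphism A -> C})
    (pi : {rmorphism C -> D}) (g : {rmorphism B -> D}),
    (forall d, exists c, pi c = d) ->
    (forall x y, pi x = 0 -> pi y = 0 -> x * y = 0) ->
    (forall a, g (phi a) = pi (iota a)) ->
  exists h : {rmorphism B -> C},
    (forall a, h (phi a) = iota a) /\ (forall b, pi (h b) = g b).

Definition smooth : Prop := finitely_presented /\ formally_smooth.

(* Elements of M (x)_A B are represented by formal sums of pure tensors, modulo
   the following congruence. *)
Inductive tensor_eq (M : lmodType A) : seq (M * B) -> seq (M * B) -> Prop :=
| TensorRefl s : tensor_eq s s
| TensorSym s t : tensor_eq s t -> tensor_eq t s
| TensorTrans s t u : tensor_eq s t -> tensor_eq t u -> tensor_eq s u
| TensorCat s s' t t' :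
    tensor_eq s s' -> tensor_eq t t' -> tensor_eq (s ++ t) (s' ++ t')
| TensorComm s t : tensor_eq (s ++ t) (t ++ s)
| TensorDl m m' b : tensor_eq [:: (m + m', b)] [:: (m, b); (m', b)]
| TensorDr m b b' : tensor_eq [:: (m, b + b')] [:: (m, b); (m, b')]
| TensorZ a m b : tensor_eq [:: (a *: m, b)] [:: (m, phi a * b)]
| Tensor0 b : tensor_eq [:: (0, b)] [::].

(* - (x)_A B preserves injections. *)
Definition flat : Prop :=
  forall (M N : lmodType A) (u : {linear M -> N}), injective u ->
  forall s t : seq (M * B),
    tensor_eq [seq (u x.1, x.2) | x <- s] [seq (u x.1, x.2) | x <- t] ->
    tensor_eq s t.

End RingHom.

Definition essentially_smooth (A B : comPzRingType) (phi : {rmorphism A -> B}) :=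
  exists (C : comPzRingType) (psi : {rmorphism A -> C}),
    smooth psi /\ is_localisation_of phi psi.

Record opens (X : topologicalType) : Type := Opens {
  op_set :> X -> Prop;
  op_open : open op_set
}.

Definition op_full (X : topologicalType) : opens X := Opens (@openT X).

Definition op_cap (X : topologicalType) (U V : opens X) : opens X :=
  Opens (openI (op_open U) (op_open V)).

Definition op_le (X : topologicalType) (U V : opens X) : Prop :=
  forall x, U x -> V x.

Record ringed_space : Type := RingedSpace {
  rs_top :> topologicalType;
  rs_O : opens rs_top -> comPzRingType;
  rs_res : forall U V : opens rs_top,
    op_le V U -> {rmorphism rs_O U -> rs_O V};
  rs_res_id : forall U (h : op_le U U) s, rs_res h s = s;
  rs_res_comp : forall U V W (h : op_le V U) (k : op_le W V) (l : op_le W U) s,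
    rs_res k (rs_res h s) = rs_res l s;
  rs_sep : forall U (I : Type) (F : I -> opens rs_top)
    (FU : forall i, op_le (F i) U), (forall x, U x -> exists i, F i x) ->
    forall s t, (forall i, rs_res (FU i) s = rs_res (FU i) t) -> s = t;
  rs_glue : forall U (I : Type) (F : I -> opens rs_top)
    (FU : forall i, op_le (F i) U), (forall x, U x -> exists i, F i x) ->
    forall s : (forall i, rs_O (F i)),
    (forall i j W (hi : op_le W (F i)) (hj : op_le W (F j)),
       rs_res hi (s i) = rs_res hj (s j)) ->
    exists t, forall i, rs_res (FU i) t = s i
}.

Section Stalk.
Variables (X : ringed_space) (x : X).

Record germ : Type := Germ {
  gm_dom : opens X;
  gm_in : gm_dom x;
  gm_sec : rs_O gm_dom
}.

Definition germ_eq (g h : germ) : Prop :=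
  exists W : opens X, W x /\
  exists (k : op_le W (gm_dom g)) (l : op_le W (gm_dom h)),
    rs_res k (gm_sec g) = rs_res l (gm_sec h).

Lemma op_le_capl (U V : opens X) : op_le (op_cap U V) U.
Proof. by move=> y []. Qed.

Lemma op_le_capr (U V : opens X) : op_le (op_cap U V) V.
Proof. by move=> y []. Qed.

Lemma op_le_trans (U V W : opens X) : op_le U V -> op_le V W -> op_le U W.
Proof. by move=> h k y /h/k. Qed.

Lemma rs_resK (U V W : opens X) (h : op_le V U) (k : op_le W V) (s : rs_O U) :
  rs_res k (rs_res h s) = rs_res (op_le_trans k h) s.
Proof. exact: rs_res_comp. Qed.

Lemma rs_res_irr (U V : opens X) (h k : op_le V U) (s : rs_O U) :
  rs_res h s = rs_res k s.
Proof. by congr (rs_res _ s); apply: Prop_irrelevance. Qed.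

Lemma rs_res_agree (U V W W' : opens X) (k : op_le W U) (l : op_le W V)
    (k' : op_le W' U) (l' : op_le W' V) (s : rs_O U) (t : rs_O V) :
  op_le W' W -> rs_res k s = rs_res l t -> rs_res k' s = rs_res l' t.
Proof.
by move=> m e; rewrite -(rs_res_comp k m) e; apply: rs_res_comp.
Qed.

Definition germ_zero : germ := @Germ (op_full X) I 0.
Definition germ_one : germ := @Germ (op_full X) I 1.
Definition germ_opp (g : germ) : germ := Germ (gm_in g) (- gm_sec g).
Definition germ_add (g h : germ) : germ :=
  @Germ (op_cap (gm_dom g) (gm_dom h)) (conj (gm_in g) (gm_in h))
    (rs_res (@op_le_capl _ _) (gm_sec g) + rs_res (@op_le_capr _ _) (gm_sec h)).
Definition germ_mul (g h : germ) : germ :=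
  @Germ (op_cap (gm_dom g) (gm_dom h)) (conj (gm_in g) (gm_in h))
    (rs_res (@op_le_capl _ _) (gm_sec g) * rs_res (@op_le_capr _ _) (gm_sec h)).

Fact germ_refl g : germ_eq g g.
Proof. by exists (gm_dom g); split; [exact: gm_in | exists (fun _ h => h), (fun _ h => h)]. Qed.

Fact germ_sym g h : germ_eq g h -> germ_eq h g.
Proof. by case=> W [Wx [k [l e]]]; exists W; split=> //; exists l, k. Qed.

Fact germ_trans g h i : germ_eq g h -> germ_eq h i -> germ_eq g i.
Proof.
case=> W [Wx [k [l e]]] [W' [W'x [k' [l' e']]]].
have c := @op_le_capl W W'; have c' := @op_le_capr W W'.
exists (op_cap W W'); split=> //.
exists (op_le_trans c k), (op_le_trans c' l').
rewrite (rs_res_agree (op_le_trans c k) (op_le_trans c l) c e).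
by apply: rs_res_agree e'.
Qed.

Fact germ_oppE g g' : germ_eq g g' -> germ_eq (germ_opp g) (germ_opp g').
Proof.
by case=> W [Wx [k [l e]]]; exists W; split=> //; exists k, l; rewrite !rmorphN e.
Qed.

Lemma germ_op2 (g g' h h' : germ) : germ_eq g g' -> germ_eq h h' ->
  exists W : opens X, W x /\
  exists (k : op_le W (op_cap (gm_dom g) (gm_dom h)))
         (l : op_le W (op_cap (gm_dom g') (gm_dom h'))),
    rs_res k (rs_res (@op_le_capl _ _) (gm_sec g)) =
      rs_res l (rs_res (@op_le_capl _ _) (gm_sec g')) /\
    rs_res k (rs_res (@op_le_capr _ _) (gm_sec h)) =
      rs_res l (rs_res (@op_le_capr _ _) (gm_sec h')).
Proof.
case=> W [Wx [k [l e]]] [W' [W'x [k' [l' e']]]].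
exists (op_cap W W'); split=> //.
exists (fun y Wy => conj (k y (proj1 Wy)) (k' y (proj2 Wy))).
exists (fun y Wy => conj (l y (proj1 Wy)) (l' y (proj2 Wy))).
split; rewrite !rs_resK.
  by apply: rs_res_agree e; apply: op_le_capl.
by apply: rs_res_agree e'; apply: op_le_capr.
Qed.

Fact germ_addE g g' h h' : germ_eq g g' -> germ_eq h h' ->
  germ_eq (germ_add g h) (germ_add g' h').
Proof.
move=> gg hh; have [W [Wx [k [l [e e']]]]] := germ_op2 gg hh.
by exists W; split=> //; exists k, l; rewrite !rmorphD e e'.
Qed.

Fact germ_mulE g g' h h' : germ_eq g g' -> germ_eq h h' ->
  germ_eq (germ_mul g h) (germ_mul g' h').
Proof.
move=> gg hh; have [W [Wx [k [l [e e']]]]] := germ_op2 gg hh.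
by exists W; split=> //; exists k, l; rewrite !rmorphM e e'.
Qed.

Lemma germ_eqI (g h : germ) :
  rs_res (@op_le_capl (gm_dom g) (gm_dom h)) (gm_sec g) =
    rs_res (@op_le_capr (gm_dom g) (gm_dom h)) (gm_sec h) -> germ_eq g h.
Proof.
move=> e; exists (op_cap (gm_dom g) (gm_dom h)).
by split; [split; exact: gm_in | exists (@op_le_capl _ _), (@op_le_capr _ _)].
Qed.

Fact germ_addA g h i :
  germ_eq (germ_add g (germ_add h i)) (germ_add (germ_add g h) i).
Proof.
apply: germ_eqI; rewrite /= !rmorphD !rs_resK /= addrA.
by congr (_ + _ + _); exact: rs_res_irr.
Qed.

Fact germ_addC g h : germ_eq (germ_add g h) (germ_add h g).
Proof.
apply: germ_eqI; rewrite /= !rmorphD !rs_resK addrC.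
by congr (_ + _); exact: rs_res_irr.
Qed.

Fact germ_add0 g : germ_eq (germ_add germ_zero g) g.
Proof.
apply: germ_eqI; rewrite /= rmorphD !rs_resK rmorph0 add0r.
exact: rs_res_irr.
Qed.

Fact germ_addN g : germ_eq (germ_add (germ_opp g) g) germ_zero.
Proof.
apply: germ_eqI; rewrite /= rmorphD !rs_resK rmorphN rmorph0.
by apply/eqP; rewrite addrC subr_eq0; apply/eqP; exact: rs_res_irr.
Qed.

Fact germ_mulA g h i :
  germ_eq (germ_mul g (germ_mul h i)) (germ_mul (germ_mul g h) i).
Proof.
apply: germ_eqI; rewrite /= !rmorphM !rs_resK /= mulrA.
by congr (_ * _ * _); exact: rs_res_irr.
Qed.

Fact germ_mulC g h : germ_eq (germ_mul g h) (germ_mul h g).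
Proof.
apply: germ_eqI; rewrite /= !rmorphM !rs_resK mulrC.
by congr (_ * _); exact: rs_res_irr.
Qed.

Fact germ_mul1 g : germ_eq (germ_mul germ_one g) g.
Proof.
apply: germ_eqI; rewrite /= rmorphM !rs_resK rmorph1 mul1r.
exact: rs_res_irr.
Qed.

Fact germ_mulD g h i :
  germ_eq (germ_mul (germ_add g h) i) (germ_add (germ_mul g i) (germ_mul h i)).
Proof.
apply: germ_eqI; rewrite /= !(rmorphD, rmorphM, rs_resK) mulrDl.
by congr (_ * _ + _ * _); exact: rs_res_irr.
Qed.

Definition germ_preRing : preRing :=
  @PreRing germ germ_eq germ_zero germ_one germ_opp germ_add germ_mul
    germ_refl germ_sym germ_trans germ_oppE germ_addE germ_mulE
    germ_addA germ_addC germ_add0 germ_addN germ_mulA germ_mulC germ_mul1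
    germ_mulD.

Definition stalk : comPzRingType := pr_quot germ_preRing.

Definition to_stalk (U : opens X) (Ux : U x) (s : rs_O U) : stalk :=
  pr_pi (P := germ_preRing) (Germ Ux s).

Lemma to_stalk_eq (U V : opens X) (Ux : U x) (Vx : V x) (s : rs_O U) (t : rs_O V) :
  to_stalk Ux s = to_stalk Vx t <-> germ_eq (Germ Ux s) (Germ Vx t).
Proof. by split=> [/(pr_pi_inj (P := germ_preRing))|h]; last exact: pr_pi_eq. Qed.

Lemma to_stalkB (U V : opens X) (Ux : U x) (Vx : V x) (s : rs_O U) (t : rs_O V) :
  to_stalk Ux s - to_stalk Vx t = @to_stalk (op_cap U V) (conj Ux Vx)
    (rs_res (@op_le_capl _ _) s - rs_res (@op_le_capr _ _) t).
Proof.
rewrite -rmorphN; transitivity (to_stalk Ux s + to_stalk Vx (- t)).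
  by congr (_ + _); apply: (prq_oppE (P := germ_preRing)).
exact: (prq_addE (P := germ_preRing)).
Qed.

Lemma to_stalkM (U V : opens X) (Ux : U x) (Vx : V x) (s : rs_O U) (t : rs_O V) :
  to_stalk Ux s * to_stalk Vx t = @to_stalk (op_cap U V) (conj Ux Vx)
    (rs_res (@op_le_capl _ _) s * rs_res (@op_le_capr _ _) t).
Proof. exact: (prq_mulE (P := germ_preRing)). Qed.

Lemma to_stalk1 : to_stalk (U := op_full X) I 1 = 1.
Proof. by []. Qed.

Lemma stalkP (Q : stalk -> Prop) :
  (forall (U : opens X) (Ux : U x) (s : rs_O U), Q (to_stalk Ux s)) -> forall g, Q g.
Proof. by move=> h; apply: pr_quotP => -[U Ux s]; apply: h. Qed.

End Stalk.

Definition op_preim (X Y : topologicalType) (f : X -> Y) (cf : continuous f)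
    (V : opens Y) : opens X :=
  Opens (proj1 (continuousP f) cf (op_set V) (op_open V)).

Lemma op_preim_le (X Y : topologicalType) (f : X -> Y) (cf : continuous f)
  (U V : opens Y) : op_le V U -> op_le (op_preim cf V) (op_preim cf U).
Proof. by move=> h x; apply: h. Qed.

Record ringed_mor (X Y : ringed_space) : Type := RingedMor {
  rm_fun :> X -> Y;
  rm_cont : continuous rm_fun;
  rm_sharp : forall V : opens Y, {rmorphism rs_O V -> rs_O (op_preim rm_cont V)};
  rm_nat : forall (U V : opens Y) (h : op_le V U) s,
    rs_res (op_preim_le h) (rm_sharp U s) = rm_sharp V (rs_res h s)
}.

Arguments rm_cont {X Y} r : rename.

Section StalkMap.
Variables (X Y : ringed_space) (f : ringed_mor X Y) (x : X).

Definition stalk_map (g : stalk (f x)) : stalk x :=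
  let r : germ (f x) := pr_repr g in
  @to_stalk X x (op_preim (rm_cont f) (gm_dom r)) (gm_in r)
    (rm_sharp f (gm_dom r) (gm_sec r)).

Lemma stalk_mapE (V : opens Y) (Vx : V (f x)) (s : rs_O V) :
  stalk_map (to_stalk Vx s) =
    @to_stalk X x (op_preim (rm_cont f) V) Vx (rm_sharp f V s).
Proof.
apply/to_stalk_eq.
have [W [Wx [k [l e]]]] := pr_repr_pi (P := germ_preRing (f x)) (Germ Vx s).
exists (op_preim (rm_cont f) W); split=> //.
by exists (op_preim_le k), (op_preim_le l); rewrite /= !rm_nat e.
Qed.

Fact stalk_map_zmod : zmod_morphism stalk_map.
Proof.
elim/stalkP=> U Ux s; elim/stalkP=> V Vx t.
rewrite to_stalkB !stalk_mapE to_stalkB; apply/to_stalk_eq/germ_eqI.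
rewrite /= !rmorphB -!rm_nat !rs_resK.
by congr (_ - _); exact: rs_res_irr.
Qed.

Fact stalk_map_monoid : monoid_morphism stalk_map.
Proof.
split.
  rewrite -[1]/(@to_stalk Y (f x) (op_full Y) I 1) stalk_mapE.
  by apply/to_stalk_eq/germ_eqI; rewrite /= !rmorph1.
elim/stalkP=> U Ux s; elim/stalkP=> V Vx t.
rewrite to_stalkM !stalk_mapE to_stalkM; apply/to_stalk_eq/germ_eqI.
rewrite /= !rmorphM -!rm_nat !rs_resK.
by congr (_ * _); exact: rs_res_irr.
Qed.

HB.instance Definition _ := GRing.isZmodMorphism.Build
  (stalk (f x)) (stalk x) stalk_map stalk_map_zmod.
HB.instance Definition _ := GRing.isMonoidMorphism.Build
  (stalk (f x)) (stalk x) stalk_map stalk_map_monoid.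

End StalkMap.

Section SpecTopology.
Variable A : comPzRingType.

Definition zariski_open : set (set (spec A)) :=
  [set W | exists E : set A, W = [set p : spec A | ~ (E `<=` sp_set p)]].

Fact zariski_openT : zariski_open setT.
Proof.
by exists setT; apply/seteqP; split=> // p _ /(_ 1 I); apply: sp_proper.
Qed.

Fact zariski_openI : setI_closed zariski_open.
Proof.
move=> _ _ [E ->] [F ->]; exists [set z | exists x y, [/\ E x, F y & z = x * y]].
apply/seteqP; split=> p /=.
  move=> [/existsNP[x /not_implyP[Ex px]] /existsNP[y /not_implyP[Fy py]]].
  move=> /(_ (x * y)) h; have /sp_prime[]// : p (x * y).
  by apply: h; exists x, y.
move=> h; split=> hE; apply: h => _ [x [y [Ex Fy ->]]].
  by apply: idealMr; [exact: sp_ideal | exact: hE].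
by case: (sp_ideal p) => _ _; apply; apply: hE.
Qed.

Fact zariski_open_bigU (I : Type) (f : I -> set (spec A)) :
  (forall i, zariski_open (f i)) -> zariski_open (\bigcup_i f i).
Proof.
move=> /choice[E fE]; exists (\bigcup_i E i); apply/seteqP; split=> p /=.
  by move=> [i _]; rewrite fE => h s; apply: h => x Ex; apply: s; exists i.
move=> /existsNP[x /not_implyP[[i _ Eix] px]]; exists i => //.
by rewrite fE => /(_ x Eix).
Qed.

HB.instance Definition _ :=
  isOpenTopological.Build (spec A) zariski_openT zariski_openI zariski_open_bigU.

Lemma zariski_openE (W : set (spec A)) : open W <-> zariski_open W.
Proof. by []. Qed.

End SpecTopology.

Section StructureSheaf.
Variable A : comPzRingType.

Section Sections.
Variable U : opens (spec A).

(* Functions on U with values in the local rings, locally given by a fraction. *)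
Record spec_sec : Type := SpecSec {
  ss_val :> forall p : spec A, U p -> loc (sp_compl p);
  ss_loc : forall p, U p -> exists V : opens (spec A), V p /\
    exists (VU : op_le V U) (a g : A), forall q (Vq : V q),
    exists gq : sp_compl q g, ss_val (VU q Vq) = frac a gq
}.

HB.instance Definition _ := gen_eqMixin spec_sec.
HB.instance Definition _ := gen_choiceMixin spec_sec.

Lemma ss_ext (s t : spec_sec) : (forall p (Up : U p), s p Up = t p Up) -> s = t.
Proof.
case: s t => [s hs] [t ht] /= h.
have e : s = t by do 2![apply: functional_extensionality_dep => ?]; apply: h.
by subst t; congr SpecSec; apply: Prop_irrelevance.
Qed.

Definition ss_const (a : A) : spec_sec.
Proof.
exists (fun p _ => to_loc (sp_compl p) a) => p Up; exists U; split=> //.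
by exists (fun _ h => h), a, 1 => q Uq; exists (ms_one (sp_compl q)).
Defined.

Definition ss_opp (s : spec_sec) : spec_sec.
Proof.
exists (fun p Up => - s p Up) => p Up.
have [V [Vp [VU [a [g h]]]]] := ss_loc s Up; exists V; split=> //.
exists VU, (- a), g => q Vq; have [gq e] := h q Vq; exists gq.
by rewrite e fracN.
Defined.

Definition ss_add (s t : spec_sec) : spec_sec.
Proof.
exists (fun p Up => s p Up + t p Up) => p Up.
have [V [Vp [VU [a [g h]]]]] := ss_loc s Up.
have [V' [V'p [VU' [a' [g' h']]]]] := ss_loc t Up.
exists (op_cap V V'); split=> //; exists (fun q Wq => VU q (proj1 Wq)).
exists (a * g' + a' * g), (g * g') => q [Vq Vq'].
have [gq e] := h q Vq; have [gq' e'] := h' q Vq'.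
exists (ms_mul gq gq').
rewrite -fracD -e -e' (Prop_irrelevance (VU' q Vq') (VU q Vq)).
by rewrite (Prop_irrelevance (VU q (proj1 _)) (VU q Vq)).
Defined.

Definition ss_mul (s t : spec_sec) : spec_sec.
Proof.
exists (fun p Up => s p Up * t p Up) => p Up.
have [V [Vp [VU [a [g h]]]]] := ss_loc s Up.
have [V' [V'p [VU' [a' [g' h']]]]] := ss_loc t Up.
exists (op_cap V V'); split=> //; exists (fun q Wq => VU q (proj1 Wq)).
exists (a * a'), (g * g') => q [Vq Vq'].
have [gq e] := h q Vq; have [gq' e'] := h' q Vq'.
exists (ms_mul gq gq').
rewrite -fracM -e -e' (Prop_irrelevance (VU' q Vq') (VU q Vq)).
by rewrite (Prop_irrelevance (VU q (proj1 _)) (VU q Vq)).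
Defined.

Fact ss_addA : associative ss_add.
Proof. by move=> s t u; apply: ss_ext => p Up /=; rewrite addrA. Qed.

Fact ss_addC : commutative ss_add.
Proof. by move=> s t; apply: ss_ext => p Up /=; rewrite addrC. Qed.

Fact ss_add0 : left_id (ss_const 0) ss_add.
Proof. by move=> s; apply: ss_ext => p Up /=; rewrite rmorph0 add0r. Qed.

Fact ss_addN : left_inverse (ss_const 0) ss_opp ss_add.
Proof. by move=> s; apply: ss_ext => p Up /=; rewrite rmorph0 addNr. Qed.

HB.instance Definition _ :=
  GRing.isZmodule.Build spec_sec ss_addA ss_addC ss_add0 ss_addN.

Fact ss_mulA : associative ss_mul.
Proof. by move=> s t u; apply: ss_ext => p Up /=; rewrite mulrA. Qed.

Fact ss_mulC : commutative ss_mul.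
Proof. by move=> s t; apply: ss_ext => p Up /=; rewrite mulrC. Qed.

Fact ss_mul1 : left_id (ss_const 1) ss_mul.
Proof. by move=> s; apply: ss_ext => p Up /=; rewrite rmorph1 mul1r. Qed.

Fact ss_mulD : left_distributive ss_mul ss_add.
Proof. by move=> s t u; apply: ss_ext => p Up /=; rewrite mulrDl. Qed.

HB.instance Definition _ :=
  GRing.Zmodule_isComPzRing.Build spec_sec ss_mulA ss_mulC ss_mul1 ss_mulD.

End Sections.

Section Restriction.
Variables (U V : opens (spec A)) (h : op_le V U).

Definition ss_res (s : spec_sec U) : spec_sec V.
Proof.
exists (fun p Vp => s p (h Vp)) => p Vp.
have [W [Wp [WU [a [g e]]]]] := ss_loc s (h Vp).
exists (op_cap W V); split=> //; exists (fun _ w => proj2 w), a, g => q Wq.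
have [gq eq] := e q (proj1 Wq); exists gq; rewrite -eq.
by congr (s q _); apply: Prop_irrelevance.
Defined.

Fact ss_res_zmod : zmod_morphism ss_res.
Proof. by move=> s t; apply: ss_ext. Qed.

Fact ss_res_monoid : monoid_morphism ss_res.
Proof. by split=> [|s t]; apply: ss_ext. Qed.

HB.instance Definition _ :=
  GRing.isZmodMorphism.Build (spec_sec U) (spec_sec V) ss_res ss_res_zmod.
HB.instance Definition _ :=
  GRing.isMonoidMorphism.Build (spec_sec U) (spec_sec V) ss_res ss_res_monoid.

End Restriction.

Fact ss_res_id U (h : op_le U U) (s : spec_sec U) : ss_res h s = s.
Proof.
by apply: ss_ext => p Up /=; congr (s p _); apply: Prop_irrelevance.
Qed.

Fact ss_res_comp (U V W : opens (spec A)) (h : op_le V U) (k : op_le W V)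
  (l : op_le W U) (s : spec_sec U) : ss_res k (ss_res h s) = ss_res l s.
Proof.
by apply: ss_ext => p Wp /=; congr (s p _); apply: Prop_irrelevance.
Qed.

Fact ss_sep (U : opens (spec A)) (I : Type) (F : I -> opens (spec A))
  (FU : forall i, op_le (F i) U) : (forall x, U x -> exists i, F i x) ->
  forall s t : spec_sec U, (forall i, ss_res (FU i) s = ss_res (FU i) t) -> s = t.
Proof.
move=> cov s t e; apply: ss_ext => p Up; have [i Fp] := cov p Up.
have /(congr1 (fun w : spec_sec (F i) => w p Fp)) /= := e i.
by rewrite (Prop_irrelevance (FU i p Fp) Up).
Qed.

Fact ss_glue (U : opens (spec A)) (I : Type) (F : I -> opens (spec A))
  (FU : forall i, op_le (F i) U) : (forall x, U x -> exists i, F i x) ->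
  forall s : (forall i, spec_sec (F i)),
  (forall i j (W : opens (spec A)) (hi : op_le W (F i)) (hj : op_le W (F j)),
     ss_res hi (s i) = ss_res hj (s j)) ->
  exists t : spec_sec U, forall i, ss_res (FU i) t = s i.
Proof.
move=> cov s comp.
have agree i j p (Fi : F i p) (Fj : F j p) : s i p Fi = s j p Fj.
  pose W := op_cap (F i) (F j); have Wp : W p by [].
  pose hi : op_le W (F i) := fun _ w => proj1 w.
  pose hj : op_le W (F j) := fun _ w => proj2 w.
  have /(congr1 (fun w : spec_sec W => w p Wp)) /= := comp i j W hi hj.
  by rewrite (Prop_irrelevance (hi p Wp) Fi) (Prop_irrelevance (hj p Wp) Fj).
pose v p (Up : U p) := let c := cid (cov p Up) in s (projT1 c) p (projT2 c).
have vE p (Up : U p) i (Fi : F i p) : v p Up = s i p Fi by exact: agree.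
have vloc p : U p -> exists V : opens (spec A), V p /\
    exists (VU : op_le V U) (a g : A), forall q (Vq : V q),
    exists gq : sp_compl q g, v q (VU q Vq) = frac a gq.
  move=> Up; have [i Fp] := cov p Up.
  have [V [Vp [VF [a [g h]]]]] := ss_loc (s i) Fp.
  exists V; split=> //; exists (fun q Vq => FU i q (VF q Vq)), a, g => q Vq.
  have [gq e] := h q Vq; exists gq; rewrite -e; exact: vE.
by exists (SpecSec vloc) => i; apply: ss_ext => p Fp /=; apply: vE.
Qed.

Definition Spec : ringed_space :=
  @RingedSpace (spec A) (fun U => spec_sec U) (fun U V h => @ss_res U V h)
    ss_res_id ss_res_comp ss_sep ss_glue.

End StructureSheaf.

Section SpecMor.
Variables (A B : comPzRingType) (phi : {rmorphism A -> B}).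

Fact spec_map_continuous : continuous (spec_map phi).
Proof.
apply/continuousP => _ [E ->]; exists (phi @` E).
apply/seteqP; split=> q /= h hE; apply: h.
  by move=> x Ex; apply: hE; exists x.
by move=> _ [x Ex <-]; apply: hE.
Qed.

Section Pullback.
Variable V : opens (spec A).

Definition ss_pull (s : spec_sec V) : spec_sec (op_preim spec_map_continuous V).
Proof.
exists (fun q Vq => loc_at_map phi q (s (spec_map phi q) Vq)) => q Vq.
have [W [Wq [WV [a [g h]]]]] := ss_loc s Vq.
exists (op_preim spec_map_continuous W); split=> //.
exists (op_preim_le WV), (phi a), (phi g) => r Wr.
have [gr e] := h _ Wr; exists gr.
rewrite (Prop_irrelevance (op_preim_le WV Wr) (WV _ Wr)) e.
exact: loc_mapE.
Defined.

Fact ss_pull_zmod : zmod_morphism ss_pull.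
Proof. by move=> s t; apply: ss_ext => q Vq; apply: rmorphB. Qed.

Fact ss_pull_monoid : monoid_morphism ss_pull.
Proof.
by split=> [|s t]; apply: ss_ext => q Vq; [apply: rmorph1 | apply: rmorphM].
Qed.

HB.instance Definition _ := GRing.isZmodMorphism.Build
  (spec_sec V) (spec_sec (op_preim spec_map_continuous V)) ss_pull ss_pull_zmod.
HB.instance Definition _ := GRing.isMonoidMorphism.Build
  (spec_sec V) (spec_sec (op_preim spec_map_continuous V)) ss_pull ss_pull_monoid.

End Pullback.

Fact ss_pull_nat (U V : opens (spec A)) (h : op_le V U) (s : spec_sec U) :
  ss_res (op_preim_le h) (ss_pull s) = ss_pull (ss_res h s).
Proof.
apply: ss_ext => q Vq.
exact: (congr1 (fun k => loc_at_map phi q (s _ k)) (Prop_irrelevance _ _)).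
Qed.

Definition Spec_ringed_mor : ringed_mor (Spec B) (Spec A) :=
  @RingedMor (Spec B) (Spec A) (spec_map phi) spec_map_continuous
    (fun V => @ss_pull V) ss_pull_nat.

End SpecMor.

Definition open_immersion (X Y : ringed_space) (j : ringed_mor X Y) : Prop :=
  [/\ injective j,
      forall U : set X, open U -> open (j @` U)
    & forall V : opens Y, op_set V `<=` range j -> bijective (rm_sharp j V)].

(* The open subset U of X is affine: (U, O_X|U) is isomorphic to some Spec C. *)
Definition affine_open (X : ringed_space) (U : opens X) : Prop :=
  exists (C : comPzRingType) (j : ringed_mor (Spec C) X),
    open_immersion j /\ range j = op_set U.

Record scheme : Type := Scheme {
  sch_rs :> ringed_space;
  sch_affine : forall x : sch_rs, exists2 U, affine_open U & op_set U x
}.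

Definition is_unit (A : comPzRingType) (a : A) : Prop := exists b, a * b = 1.

Record scheme_mor (X Y : scheme) : Type := SchemeMor {
  sm_mor :> ringed_mor X Y;
  sm_local : forall (x : X) (g : stalk (sm_mor x)),
    is_unit (stalk_map g) -> is_unit g
}.

Section Identity.
Variable X : ringed_space.

Fact id_cont : continuous (@id X).
Proof. by move=> x. Qed.

Definition id_sharp (V : opens X) : {rmorphism rs_O V -> rs_O (op_preim id_cont V)} :=
  @rs_res X V (op_preim id_cont V) (fun _ h => h).

Fact id_nat (U V : opens X) (h : op_le V U) (s : rs_O U) :
  rs_res (op_preim_le (cf := id_cont) h) (id_sharp U s) = id_sharp V (rs_res h s).
Proof. by rewrite !rs_resK; apply: rs_res_irr. Qed.

Definition ringed_id : ringed_mor X X := @RingedMor X X id id_cont id_sharp id_nat.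

Lemma ringed_id_open_immersion : open_immersion ringed_id.
Proof.
split=> [p q //|U oU|V _]; first by rewrite image_id.
by exists (@rs_res X (op_preim id_cont V) V (fun _ h => h)) => s /=;
  rewrite rs_resK; apply: rs_res_id.
Qed.

End Identity.

Fact Spec_affine (A : comPzRingType) (x : Spec A) :
  exists2 U, affine_open U & op_set U x.
Proof.
exists (op_full (Spec A)) => //; exists A, (ringed_id (Spec A)).
split; first exact: ringed_id_open_immersion.
exact: image_id.
Qed.

Definition Spec_scheme (A : comPzRingType) : scheme := Scheme (@Spec_affine A).

Section SpecSchemeMor.
Variables (A B : comPzRingType) (phi : {rmorphism A -> B}).

Lemma spec_stalk_eq (C : comPzRingType) (p : Spec C) (U V : opens (Spec C))
    (Up : U p) (Vp : V p) (s : spec_sec U) (t : spec_sec V) :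
  @to_stalk (Spec C) p U Up s = @to_stalk (Spec C) p V Vp t -> s p Up = t p Vp.
Proof.
move=> /to_stalk_eq [W [Wp [/= k [/= l e]]]].
have /= := congr1 (fun w : spec_sec W => w p Wp) e.
by rewrite (Prop_irrelevance (k p Wp) Up) (Prop_irrelevance (l p Wp) Vp).
Qed.

(* The section g / a over the locus in W where a is invertible. *)
Lemma spec_inv_sec (W : opens (Spec A)) (p : Spec A) (a g : A) : W p -> ~ sp_set p a ->
  exists2 Z : opens (Spec A), Z p & op_le Z W /\
    exists t : spec_sec Z, forall r (Zr : Z r),
      exists ar : sp_compl r a, t r Zr = frac g ar.
Proof.
move=> Wp pa; have oa : open [set q : spec A | ~ sp_set q a].
  exists [set a]; apply/seteqP; split=> q /= h hq; apply: h; first exact: hq.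
  by move=> _ ->.
pose Z := op_cap W (Opens oa); exists Z; first by [].
split; first by move=> r [].
pose v r (Zr : Z r) := @frac A (sp_compl r) g a (proj2 Zr).
suff vl r : Z r -> exists V : opens (spec A), V r /\
    exists (VU : op_le V Z) (b h : A), forall q (Vq : V q),
    exists hq : sp_compl q h, v q (VU q Vq) = frac b hq.
  by exists (SpecSec vl) => r Zr; exists (proj2 Zr).
move=> Zr; exists Z; split=> //; exists (fun _ h => h), g, a => q Zq.
by exists (proj2 Zq).
Qed.

Fact Spec_local (q : Spec_scheme B) (x : stalk (Spec_ringed_mor phi q)) :
  is_unit (stalk_map x) -> is_unit x.
Proof.
elim/stalkP: x => V Vp s [y]; rewrite stalk_mapE.
elim/stalkP: y => Y Yq y; rewrite to_stalkM -to_stalk1.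
have [W [Wp [WV [a [g e]]]]] := ss_loc (s : spec_sec V) Vp.
have {}e r (Wr : W r) (Vr : V r) :
    exists gr : sp_compl r g, (s : spec_sec V) r Vr = frac a gr.
  have [gr er] := e r Wr; exists gr; rewrite -er.
  by rewrite (Prop_irrelevance (WV r Wr) Vr).
move=> /spec_stalk_eq sy.
have qa : ~ sp_set (spec_map phi q) a.
  have [h [k {}sy]] : exists h k,
      loc_at_map phi q ((s : spec_sec V) _ h) * (y : spec_sec Y) q k = 1.
    by eexists; eexists; exact: sy.
  move: sy; have [gp ->] := e _ Wp h; rewrite [loc_at_map _ _ _]loc_mapE.
  elim/locP: ((y : spec_sec Y) q k) => c d qd; rewrite fracM -frac1.
  move=> /frac_eq[u qu]; rewrite mulr1 mul1r => eq qa.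
  have : sp_set q (u * (phi g * d)).
    rewrite -eq; case: (sp_ideal q) => _ _; apply.
    exact: (idealMr c (sp_ideal q) (qa : sp_set q (phi a))).
  by case/sp_prime => // /sp_prime[].
have [Z Zp [ZW [t te]]] := spec_inv_sec g Wp qa.
exists (@to_stalk (Spec A) _ Z Zp t); rewrite to_stalkM -to_stalk1.
apply/to_stalk_eq.
have ZV : op_le Z V by move=> r /ZW/WV.
exists Z; split=> //; exists (fun r Zr => conj (ZV r Zr) Zr), (fun _ _ => I).
rewrite rmorphM rmorph1 !rs_resK; apply: ss_ext => r Zr.
suff st h k : (s : spec_sec V) r h * t r k = 1 by exact: st.
have [gr ->] := e r (ZW r Zr) h; have [ar ->] := te r k.
rewrite fracM -frac1; apply/frac_eq; exists 1; first exact: ms_one.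
by rewrite !mul1r mulr1 mulrC.
Qed.

Definition Spec_mor : scheme_mor (Spec_scheme B) (Spec_scheme A) :=
  @SchemeMor (Spec_scheme B) (Spec_scheme A) (Spec_ringed_mor phi) Spec_local.

End SpecSchemeMor.

Section SchemeMorProperties.
Variables (X Y : scheme) (f : scheme_mor X Y).

Definition affine_mor : Prop :=
  forall V : opens Y, affine_open V -> affine_open (op_preim (rm_cont f) V).

Definition strongly_An_localising (n : nat) : Prop :=
  affine_mor /\
  forall V : opens Y, affine_open V -> An_localising (rm_sharp f V) n.

Definition surjective_mor : Prop := forall y : Y, exists x : X, f x = y.

Definition flat_mor : Prop :=
  forall x : X, flat (stalk_map (f := f) (x := x) : {rmorphism _ -> _}).

Definition faithfully_flat_mor : Prop := flat_mor /\ surjective_mor.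

End SchemeMorProperties.

(* Main.v *)
Require Import Defs.
From HB Require Import structures.
From mathcomp Require Import all_boot all_algebra.
From mathcomp Require Import boolp classical_sets topology_structure.
From mathcomp Require Import ring.
Import Defs.

(** Write f for the morphism from Spec R(t) to Spec R and U for the multiplicative
   set that defines R(t).

   Let V be an affine open subset of Spec R.  The preimage of V should be the
   spectrum of D, the ring of fractions of O(V)[t] at the image of U, and then
   O(V) -> D is An-localising by construction.  To see this without fibre products
   of schemes, the inclusion of V is described algebraically: for all a with D(a)
   contained in V, the map R -> O(V) becomes an isomorphism after inverting a, and
   no prime of O(V) contains all these a (affine_open_cover).  These two conditions
   are inherited by R(t) -> D (gauss_pullback_cover), as one checks on
   coefficients and on fractions; and they imply in general that the map on spectra
   is an open immersion whose range is the union of the D(a)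
   (cover_open_immersion, cover_range).  The link between the algebra and the
   sheaves is that the sections over D(a) are the fractions with denominator a
   power of a (basic_open_vanish, basic_open_section).

   For surjectivity, a prime p of R extends to the prime p R[t] of R[t], which
   avoids U and contracts to p.  Essential smoothness holds because R[t] is smooth
   over R: homomorphisms out of it lift along every surjection.

   For flatness, the stalk of Spec R(t) at a point x is a localisation of
   polynomials over the stalk at f x, and a localised polynomial ring is flat
   (An_localising_flat): a tensor in M (x) A[t] is a polynomial with coefficients in
   M, so that an injective map M -> N gives an injective map M[t] -> N[t], and this
   persists in fractions. *)

Set Implicit Arguments.
Unset Strict Implicit.
Unset Printing Implicit Defensive.

Import GRing.Theory.
Local Open Scope classical_set_scope.
Local Open Scope ring_scope.

(** * Prime ideals *)

Section PowersAndPrimes.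
Variable A : comPzRingType.

Lemma primeX (p : spec A) f m : ~ p f -> ~ p (f ^+ m).
Proof.
move=> pf; elim: m => [|m IH]; first exact: sp_proper.
by rewrite exprS => /sp_prime[].
Qed.

Lemma primeM (p : spec A) x y : p y -> p (x * y).
Proof. by case: (sp_ideal p) => _ _ h; apply: h. Qed.

Lemma primeNM (p : spec A) x y : ~ p x -> ~ p y -> ~ p (x * y).
Proof. by move=> px py /sp_prime[]. Qed.

Lemma prime0 (p : spec A) : p 0.
Proof. by case: (sp_ideal p). Qed.

Definition powers (f : A) : mulset A.
Proof.
exists [set s | exists m, s = f ^+ m]; first by exists 0%N.
by move=> _ _ [m ->] [k ->]; exists (m + k)%N; rewrite exprD.
Defined.

Lemma powers_prime (p : spec A) f s : ~ p f -> powers f s -> ~ p s.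
Proof. by move=> pf [m ->]; apply: primeX. Qed.

Definition ms_image (B : comPzRingType) (phi : {rmorphism A -> B}) (S : mulset A) :
  mulset B.
Proof.
exists [set t | exists2 s, S s & t = phi s].
  by exists 1; [exact: ms_one | rewrite rmorph1].
move=> _ _ [s Ss ->] [t St ->]; exists (s * t); first exact: ms_mul.
by rewrite rmorphM.
Defined.

Lemma is_unitM (x y : A) : is_unit x -> is_unit y -> is_unit (x * y).
Proof. by move=> [x' ex] [y' ey]; exists (x' * y'); rewrite mulrACA ex ey mulr1. Qed.

Lemma is_unit_morph (B : comPzRingType) (phi : {rmorphism A -> B}) x :
  is_unit x -> is_unit (phi x).
Proof. by case=> y e; exists (phi y); rewrite -rmorphM e rmorph1. Qed.

Lemma unit_cancel (u x y : A) : is_unit u -> u * x = u * y -> x = y.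
Proof. by case=> v uv e; rewrite -[x]mul1r -[y]mul1r -uv (mulrC u) -!mulrA e. Qed.

(** Zorn's lemma gives an ideal J maximal among those that contain I and no
   power of f.  It is prime: if x and y are not in J, then J + (x) and J + (y)
   contain powers of f, and hence so does J + (x y). *)
Lemma prime_avoiding (I : set A) (f : A) : ideal I -> (forall m, ~ I (f ^+ m)) ->
  exists p : spec A, I `<=` sp_set p /\ ~ p f.
Proof.
move=> iI If.
pose good (J : set A) := [/\ ideal J, I `<=` J & forall m, ~ J (f ^+ m)].
have gI : good I by split.
(* the union of the empty chain is set0, which is not an ideal *)
have [F Fchain tot|J [[J0|[iJ IJ Jf]] maxJ]] :=
    @Zorn_bigcup A (fun J => J = set0 \/ good J).
- have [|/existsNP[J /not_implyP[FJ /existsNP[x Jx]]]] :=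
      pselect (forall J, F J -> J `<=` set0).
    by move=> F0; left; apply/seteqP; split=> // x [J /F0 h /h].
  have gdJ : good J by case: (Fchain J FJ) => // J0; rewrite J0 in Jx; case: Jx.
  right; split=> [|y Iy|m].
  + split=> [|y z [K FK Ky] [L FL Lz]|a y [K FK Ky]].
    * by exists J => //; case: gdJ => -[].
    * have gK : good K by case: (Fchain K FK) => // K0; rewrite K0 in Ky.
      have gL : good L by case: (Fchain L FL) => // L0; rewrite L0 in Lz.
      case: (tot K L FK FL) => KL.
        by exists L => //; case: gL => -[_ h _] _ _; apply: h => //; apply: KL.
      by exists K => //; case: gK => -[_ h _] _ _; apply: h => //; apply: KL.
    * have gK : good K by case: (Fchain K FK) => // K0; rewrite K0 in Ky.
      by exists K => //; case: gK => -[_ _ h] _ _; apply: h.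
  + by exists J => //; case: gdJ => _ h _; apply: h.
  + case=> K FK Km; have gK : good K.
      by case: (Fchain K FK) => // K0; rewrite K0 in Km.
    by case: gK => _ _ /(_ m).
- case: (maxJ I); last by right.
  rewrite J0; split=> // I0; have [Iz _ _] := iI.
  exact: (I0 0 Iz).
have pJf : ~ J f by move: (Jf 1%N); rewrite expr1.
have J1 : ~ J 1 by move: (Jf 0%N); rewrite expr0.
have [Jz JD JM] := iJ.
pose add x : set A := [set y | exists2 j, J j & exists a, y = j + a * x].
have addP x : ~ J x -> exists m, add x (f ^+ m).
  move=> Jx; apply: contrapT => /forallNP nm.
  apply: (maxJ (add x)); last first.
    right; split=> [|y /IJ Jy|//]; last first.
      by exists y => //; exists 0; rewrite mul0r addr0.
    split=> [|y z [j Jj [a ->]] [k Jk [b ->]]|b y [j Jj [a ->]]].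
    - by exists 0 => //; exists 0; rewrite mul0r addr0.
    - by exists (j + k); [exact: JD | exists (a + b); ring].
    - by exists (b * j); [exact: JM | exists (b * a); ring].
  split=> [y Jy|h]; first by exists y => //; exists 0; rewrite mul0r addr0.
  by apply: Jx; apply: h; exists 0 => //; exists 1; rewrite mul1r add0r.
have Jp x y : J (x * y) -> J x \/ J y.
  move=> Jxy; apply: contrapT => /not_orP[/addP[m [j Jj [a e]]] /addP[k [l Jl [b e']]]].
  apply: (Jf (m + k)%N); rewrite exprD e e'.
  have -> : (j + a * x) * (l + b * y) = (l + b * y) * j + (a * x * l + a * b * (x * y)).
    by ring.
  by apply: (JD) ; [exact: JM | apply: JD; apply: JM].
by exists (SpecPoint iJ J1 Jp).
Qed.

End PowersAndPrimes.

(** * Sections of the structure sheaf over a basic open set *)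

Section SpecOpens.
Variable A : comPzRingType.

Definition basic_open (f : A) : opens (spec A).
Proof.
exists [set p : spec A | ~ p f]; exists [set f]; apply/seteqP; split=> q /= h hq.
  by apply: h; apply: hq.
by apply: h => _ ->.
Defined.

Lemma basic_open_nbhs (U : opens (spec A)) (p : spec A) : U p ->
  exists2 f, ~ p f & op_le (basic_open f) U.
Proof.
case: (op_open U) => E UE; rewrite UE => /existsNP[f /not_implyP[Ef pf]].
by exists f => // q qf; rewrite UE => Eq; apply: qf; apply: Eq.
Qed.

(** Quasi-compactness of D(f).  The elements that vanish wherever some finite
   part of H vanishes form an ideal; a prime containing it and avoiding f would
   lie in D(f) and in none of the D(h). *)
Lemma basic_open_compact (f : A) (H : set A) :
  (forall p : spec A, ~ p f -> exists2 h, H h & ~ p h) ->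
  exists2 l : seq A, (forall h, h \in l -> H h) &
    forall p : spec A, ~ p f -> exists2 h, h \in l & ~ p h.
Proof.
move=> cov.
pose I : set A := [set x | exists2 l : seq A, (forall h, h \in l -> H h) &
   forall p : spec A, (forall h, h \in l -> p h) -> p x].
have iI : ideal I.
  split=> [|x y [l lH lx] [k kH ky]|a x [l lH lx]].
  - by exists [::] => // p _; exact: prime0.
  - exists (l ++ k) => [h|p ph]; first by rewrite mem_cat => /orP[/lH|/kH].
    case: (sp_ideal p) => _ hD _; apply: hD.
      by apply: lx => h hl; apply: ph; rewrite mem_cat hl.
    by apply: ky => h hl; apply: ph; rewrite mem_cat hl orbT.
  - by exists l => // p /lx; apply: primeM.
have [[m [l lH lf]]|/forallNP nI] := pselect (exists m, I (f ^+ m)).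
  exists l => // p pf; apply: contrapT => np; case: (primeX pf (m := m)); apply: lf => h hl.
  by apply: contrapT => ph; apply: np; exists h.
have [p [Ip pf]] := prime_avoiding iI nI.
have [h Hh []] := cov p pf; apply: Ip; exists [:: h] => [k|q]; first by rewrite inE => /eqP->.
by apply; rewrite inE.
Qed.

(** A prime that avoids f and contains the annihilator of a would be a point of
   D(f) where a is not zero. *)
Lemma basic_open_vanish (f a : A) :
  (forall p : spec A, ~ p f -> to_loc (sp_compl p) a = 0) -> exists m, f ^+ m * a = 0.
Proof.
move=> va; pose I : set A := [set x | x * a = 0].
have iI : ideal I.
  split=> [|x y xa ya|b x xa]; rewrite /I /= ?mul0r //.
    by rewrite mulrDl xa ya addr0.
  by rewrite -mulrA xa mulr0.
have [//|/forallNP nI] := pselect (exists m, I (f ^+ m)).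
have [p [Ip pf]] := prime_avoiding iI nI.
have /frac_eq[u pu] : frac a (ms_one (sp_compl p)) = frac 0 (ms_one (sp_compl p)).
  by rewrite -![frac _ _]/(to_loc _ _) va // rmorph0.
by rewrite !mulr1 mulr0 => /Ip.
Qed.

Lemma to_locM_frac (S : mulset A) a b (Sb : S b) : to_loc S b * frac a Sb = to_loc S a.
Proof.
by rewrite /to_loc fracM; apply/frac_eq; exists 1; [exact: ms_one | ring].
Qed.

Lemma to_loc_unit (S : mulset A) b : S b -> is_unit (to_loc S b).
Proof.
by move=> Sb; exists (frac 1 Sb); rewrite to_locM_frac rmorph1.
Qed.

(** With basic_open_vanish, this says that the sections over D(f) are A_f; for
   f = 1 they are A.  The ideal J of the multipliers x for which x s is a global
   constant is shown to meet the powers of f.  Finitely many D(h) cover D(f), with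
   s = a / h on D(h), and the differences a h' - a' h vanish on D(h h'), hence are
   killed by a power of h h'.  So J contains a power of each h, and no point of
   D(f) can contain J. *)
Lemma basic_open_section (f : A) (U : opens (spec A)) (s : spec_sec U) :
  (forall p, U p <-> ~ p f) ->
  exists m a, forall p (Up : U p), to_loc (sp_compl p) (f ^+ m) * s p Up = to_loc _ a.
Proof.
move=> Uf.
pose H (h : A) := (forall p : spec A, ~ p h -> U p) /\
  exists a, forall p (Up : U p), ~ p h -> to_loc (sp_compl p) h * s p Up = to_loc _ a.
have cov (p : spec A) : ~ p f -> exists2 h, H h & ~ p h.
  move=> /Uf Up; have [V [Vp [VU [a [g e]]]]] := ss_loc s Up.
  have [h ph hV] := basic_open_nbhs Vp.
  have [gp _] := e p Vp; exists (h * g); last exact: primeNM.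
  have hgh q : ~ sp_set q (h * g) -> ~ q h.
    by move=> qhg qh; apply: qhg; rewrite mulrC; apply: primeM.
  split; first by move=> q /hgh/hV/VU.
  exists (h * a) => q Uq /hgh/hV Vq.
  have [gq] := e q Vq; rewrite (Prop_irrelevance (VU q Vq) Uq) => ->.
  by rewrite !rmorphM -mulrA to_locM_frac.
have [l lH lcov] := basic_open_compact cov.
pose J : set A := [set x | exists a, forall p (Up : U p),
   to_loc (sp_compl p) x * s p Up = to_loc _ a].
have iJ : ideal J.
  split=> [|x y [a xa] [b yb]|b x [a xa]].
  - by exists 0 => p Up; rewrite !rmorph0 mul0r.
  - by exists (a + b) => p Up; rewrite !rmorphD mulrDl xa yb.
  - by exists (b * a) => p Up; rewrite !rmorphM -mulrA xa.
have [[m [a ma]]|/forallNP nJ] := pselect (exists m, J (f ^+ m)).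
  by exists m, a.
have [p [Jp pf]] := prime_avoiding iJ nJ.
have [h hl ph] := lcov p pf.
have [hU [a ha]] := lH h hl.
suff [N JN] : exists N, J (h ^+ N.+1).
  by case: (primeX (m := N.+1) ph); apply: Jp.
(* one exponent N serves the finitely many h' of the subcover *)
suff [N hN] : exists N, forall h', h' \in l -> exists b, forall q (Uq : U q), ~ q h' ->
    to_loc (sp_compl q) h' * s q Uq = to_loc _ b /\
    to_loc (sp_compl q) (h ^+ N * (a * h')) = to_loc _ (h ^+ N * (h * b)).
  exists N, (h ^+ N * a) => q Uq.
  have [h' h'l qh'] := lcov q (proj1 (Uf q) Uq).
  have [b hb] := hN h' h'l; have [e1 e2] := hb q Uq qh'.
  apply: (unit_cancel (to_loc_unit (S := sp_compl q) qh')).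
  rewrite mulrCA e1 -!rmorphM exprSr  -(mulrA (h ^+ N)).
  by apply: etrans (esym e2) _; congr (to_loc _ _); ring.
have : forall h', h' \in l -> H h' by [].
elim: l {hl lH lcov} => [|k l IH] lH; first by exists 0%N.
have [|N hN] := IH; first by move=> h' h'l; apply: lH; rewrite inE h'l orbT.
have [_ [b kb]] : H k by apply: lH; rewrite inE eqxx.
have [|M hM] := @basic_open_vanish (h * k) (a * k - h * b).
  move=> q qhk; have qh : ~ q h by move=> qh; apply: qhk; rewrite mulrC; apply: primeM.
  have qk : ~ q k by move=> qk; apply: qhk; apply: primeM.
  by rewrite rmorphB !rmorphM /= -(ha q (hU q qh) qh) -(kb q (hU q qh) qk); ring.
exists (M + N)%N => h'; rewrite inE => /orP[/eqP->|/hN[c hc]].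
  exists b => q Uq qk; split; first exact: kb.
  apply: (unit_cancel (to_loc_unit (S := sp_compl q) (primeX (m := M) qk))).
  rewrite -!rmorphM; congr (to_loc _ _).
  apply/eqP; rewrite -subr_eq0; apply/eqP.
  transitivity (h ^+ N * ((h * k) ^+ M * (a * k - h * b))); last by rewrite hM mulr0.
  by rewrite exprD exprMn; ring.
exists c => q Uq qh'; have [e1 e2] := hc q Uq qh'; split=> //.
rewrite exprD -!mulrA [LHS]rmorphM [RHS]rmorphM; congr (_ * _); exact: e2.
Qed.

End SpecOpens.

(** * Maps that become isomorphisms after localisation *)

Section FractionIso.

(** phi induces an isomorphism from the localisation of A at S to the localisation
   of B at phi(S), expressed without either ring of fractions. *)
Definition frac_iso (A B : comPzRingType) (S : mulset A) (phi : {rmorphism A -> B}) :=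
  (forall b, exists2 s, S s & exists a, phi s * b = phi a) /\
  (forall a, phi a = 0 -> exists2 s, S s & s * a = 0).

(** The largest multiplicative set that phi inverts: a ring map phi is a
   localisation exactly when it satisfies frac_iso for this set. *)
Definition unit_preim (A B : comPzRingType) (phi : {rmorphism A -> B}) : mulset A.
Proof.
exists [set s | is_unit (phi s)]; first by exists 1; rewrite rmorph1 mulr1.
by move=> x y ux uy /=; rewrite rmorphM; apply: is_unitM.
Defined.

Lemma frac_iso_sub (A B : comPzRingType) (S T : mulset A) (phi : {rmorphism A -> B}) :
  (forall s, S s -> T s) -> frac_iso S phi -> frac_iso T phi.
Proof.
move=> ST [su inj]; split=> [b|a /inj[s Ss e]]; last by exists s => //; apply: ST.
by have [s Ss [a e]] := su b; exists s; [exact: ST | exists a].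
Qed.

Lemma frac_iso_to_loc (A : comPzRingType) (S : mulset A) : frac_iso S (to_loc S).
Proof.
split=> [|a].
  by elim/locP => a s Ss; exists s => //; exists a; apply: to_locM_frac.
rewrite -[0](rmorph0 (to_loc S)) => /frac_eq[u Su].
by rewrite !mulr1 mulr0 => e; exists u.
Qed.

Lemma frac_iso_ker (A B : comPzRingType) (S : mulset A) (phi : {rmorphism A -> B}) :
  frac_iso S phi -> forall a b, phi a = phi b -> exists2 s, S s & s * a = s * b.
Proof.
move=> [_ inj] a b e; have [|s Ss h] := inj (a - b); first by rewrite rmorphB e subrr.
by exists s => //; apply/eqP; rewrite -subr_eq0 -mulrBr h.
Qed.

Lemma frac_iso_comp (A B C : comPzRingType) (S : mulset A) (T : mulset B)
    (phi : {rmorphism A -> B}) (psi : {rmorphism B -> C}) :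
  (forall s, S s -> is_unit (phi s)) -> (forall t, T t -> is_unit (psi t)) ->
  frac_iso S phi -> frac_iso T psi -> frac_iso (unit_preim (psi \o phi)) (psi \o phi).
Proof.
move=> uS uT [suS injS] [suT injT]; split=> [c|a /= /injT[t Tt e]].
  have [t Tt [b e]] := suT c; have [s Ss [a ea]] := suS b.
  have [s' Ss' [a' ea']] := suS t; exists (s * a') => /=.
    rewrite rmorphM -ea' [psi _]rmorphM rmorphM.
    apply: is_unitM; first exact/is_unit_morph/uS.
    by apply: is_unitM; [exact/is_unit_morph/uS | exact: uT].
  exists (s' * a); rewrite /= [phi _]rmorphM -ea' [phi (s' * a)]rmorphM -ea.
  by rewrite !rmorphM -e; ring.
have [s Ss [a' ea']] := suS t.
have [|s' Ss' e'] := injS (a' * a); first by rewrite rmorphM -ea' -mulrA e mulr0.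
exists (s' * a'); last by rewrite -mulrA.
rewrite /= [phi _]rmorphM -ea' rmorphM [psi (_ * t)]rmorphM.
apply: is_unitM; first exact/is_unit_morph/uS.
by apply: is_unitM; [exact/is_unit_morph/uS | exact: uT].
Qed.

Lemma frac_iso_cancel (A A' B : comPzRingType) (S : mulset A) (phi : {rmorphism A -> A'})
    (psi : {rmorphism A' -> B}) (chi : {rmorphism A -> B}) :
  (forall a, psi (phi a) = chi a) -> (forall s, S s -> is_unit (phi s)) ->
  frac_iso S phi -> frac_iso (unit_preim chi) chi -> frac_iso (unit_preim psi) psi.
Proof.
move=> e uS [suS injS] [su inj]; split=> [b|a' a'0].
  have [s us [a ea]] := su b; exists (phi s); first by rewrite /= e.
  by exists (phi a); rewrite !e.
have [s Ss [a ea]] := suS a'.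
have [|t ut ta] := inj a; first by rewrite -e -ea rmorphM a'0 mulr0.
exists (phi t * phi s) => /=.
  rewrite rmorphM; apply: is_unitM; first by rewrite e.
  exact/is_unit_morph/uS.
by rewrite -mulrA ea -rmorphM ta rmorph0.
Qed.

Lemma frac_iso_localisation (A B C : comPzRingType) (phi : {rmorphism A -> B})
    (psi : {rmorphism A -> C}) (chi : {rmorphism C -> B}) :
  (forall a, chi (psi a) = phi a) -> frac_iso (unit_preim chi) chi ->
  is_localisation_of phi psi.
Proof.
move=> e iso; have [su inj] := iso; pose S := unit_preim chi; exists S.
(* c / s is sent to the unique b with chi s * b = chi c *)
have exb (x : loc S) : exists b, forall c s (Ss : S s), x = frac c Ss -> chi s * b = chi c.
  elim/locP: x => c s Ss; have [v sv] := (Ss : is_unit (chi s)).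
  exists (chi c * v) => d t St /frac_eq[u Su e']; apply: (unit_cancel Su).
  rewrite -[RHS]mulr1 -sv -!mulrA [in RHS]mulrCA !mulrA -!rmorphM.
  have -> : u * t * c = u * (c * t) by ring.
  by rewrite e'; congr (chi _ * _); ring.
have [h hP] := choice exb.
have hE c s (Ss : S s) b : chi s * b = chi c -> h (frac c Ss) = b.
  by move=> eb; apply: (unit_cancel Ss); rewrite (hP _ c s Ss erefl).
have hZ : zmod_morphism h.
  elim/locP => a s Ss; elim/locP => b t St.
  rewrite fracN fracD; apply: hE; rewrite mulNr !rmorphD rmorphN !rmorphM.
  by rewrite -(hP _ a s Ss erefl) -(hP _ b t St erefl); ring.
have hM : monoid_morphism h.
  split; first by rewrite -frac1; apply: hE; rewrite mulr1.
  elim/locP => a s Ss; elim/locP => b t St.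
  rewrite fracM; apply: hE; rewrite !rmorphM.
  by rewrite -(hP _ a s Ss erefl) -(hP _ b t St erefl); ring.
pose hZM := GRing.isZmodMorphism.Build (loc S) B h hZ.
pose hMM := GRing.isMonoidMorphism.Build (loc S) B h hM.
pose hh : {rmorphism loc S -> B} := HB.pack h hZM hMM.
exists hh; split; last by move=> a; rewrite /= -e; apply: hE; rewrite rmorph1 mul1r.
have hinj x y : h x = h y -> x = y.
  elim/locP: x => a s Ss; elim/locP: y => b t St eh.
  have [|u Su eu] := frac_iso_ker iso (a := a * t) (b := b * s).
    by rewrite !rmorphM -(hP _ a s Ss erefl) -(hP _ b t St erefl) eh; ring.
  by apply/frac_eq; exists u.
have hsur b : exists x, h x = b.
  by have [s Ss [c ec]] := su b; exists (frac c Ss); apply: hE.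
have [k kP] := choice hsur.
by exists k => [x|b] /=; [apply: hinj; rewrite kP | rewrite kP].
Qed.

(** The prime over p consists of the b that agree, up to a multiplier from S, with
   the image of an element of p. *)
Lemma frac_iso_prime_lift (A B : comPzRingType) (S : mulset A) (phi : {rmorphism A -> B})
    (p : spec A) : frac_iso S phi -> (forall s, S s -> ~ p s) ->
  exists q : spec B, spec_map phi q = p.
Proof.
move=> iso pS; have [su inj] := iso.
pose Q : set B := [set b | exists2 s, S s & exists2 a, p a & phi s * b = phi a].
have QE s b a : S s -> phi s * b = phi a -> Q b -> p a.
  move=> Ss e [t St [c pc e']].
  have [|u Su eu] := frac_iso_ker iso (a := s * c) (b := t * a).
    by rewrite !rmorphM -e -e'; ring.
  have : p (u * (t * a)) by rewrite -eu; do 2![apply: primeM].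
  by case/sp_prime => [/pS|/sp_prime[/pS|]] //.
have iQ : ideal Q.
  split.
  - by exists 1; [exact: ms_one | exists 0; [exact: prime0 | rewrite rmorph0 mulr0]].
  - move=> x y [s Ss [a pa ea]] [t St [b pb eb]]; exists (s * t); first exact: ms_mul.
    exists (t * a + s * b); last by rewrite rmorphD !rmorphM -ea -eb; ring.
    by case: (sp_ideal p) => _ hD _; apply: hD; apply: primeM.
  - move=> x y [s Ss [a pa ea]]; have [t St [b eb]] := su x.
    exists (t * s); first exact: ms_mul.
    by exists (b * a); [exact: primeM | rewrite !rmorphM -ea -eb; ring].
have Q1 : ~ Q 1.
  by move=> /(QE 1 1 1 (ms_one S)) h; apply: (@sp_proper _ p); apply: h; rewrite mulr1.
have Qp x y : Q (x * y) -> Q x \/ Q y.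
  have [s Ss [a ea]] := su x; have [t St [b eb]] := su y.
  move=> /(QE (s * t) _ (a * b) (ms_mul Ss St)) h.
  have /sp_prime[pa|pb] : p (a * b) by apply: h; rewrite !rmorphM -ea -eb; ring.
    by left; exists s => //; exists a.
  by right; exists t => //; exists b.
exists (SpecPoint iQ Q1 Qp); apply: sp_ext => a; split=> [|pa].
  by apply: (QE 1); [exact: ms_one | rewrite rmorph1 mul1r].
by exists 1; [exact: ms_one | exists a; rewrite ?rmorph1 ?mul1r].
Qed.

(** A multiplier from S moves the numerator of b / phi u into the image of A; the
   denominator is there already. *)
Lemma frac_iso_loc_map (A B : comPzRingType) (S U : mulset A) (phi : {rmorphism A -> B})
    (UV : forall u, U u -> ms_image phi U (phi u)) :
  frac_iso S phi ->
  frac_iso (ms_image (to_loc U) S) (loc_map (T := ms_image phi U) UV).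
Proof.
move=> [su inj]; split.
  elim/locP => b t Vt; have [u Uu tu] := Vt; have [s Ss [a ea]] := su b.
  exists (to_loc U s); first by exists s.
  exists (frac a Uu); rewrite [X in X * _]loc_mapE [RHS]loc_mapE fracM; apply/frac_eq.
  by exists 1; [exact: ms_one | rewrite ea tu rmorph1; ring].
elim/locP => a u Uu; rewrite [LHS]loc_mapE => /(congr1 ( *%R (to_loc (ms_image phi U) (phi u)))).
rewrite (to_locM_frac) mulr0 -[0](rmorph0 (to_loc (ms_image phi U))) => /frac_eq[_ [w Uw ->]].
rewrite !mulr1 mulr0 -rmorphM => /inj[s Ss e].
exists (to_loc U s); first by exists s.
rewrite /to_loc fracM -[0](rmorph0 (to_loc U)); apply/frac_eq; exists w => //.
by rewrite mul0r mulr0 mulr1 mulrCA.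
Qed.

End FractionIso.

(** * Polynomial rings *)

Section Poly1Maps.
Variables (A B : comPzRingType).

Lemma p1_coefD (f g : poly1 A) i : (f + g) i = f i + g i.
Proof. by []. Qed.

Lemma p1_coefB (f g : poly1 A) i : (f - g) i = f i - g i.
Proof. by []. Qed.

Lemma p1_coef0 i : (0 : poly1 A) i = 0.
Proof. exact: if_same. Qed.

Lemma p1_coefM (f g : poly1 A) i : (f * g) i = \sum_(j < i.+1) f j * g (i - j)%N.
Proof. by []. Qed.

Lemma p1_monoE (f : poly1 A) N i :
  (p1_mono A N * f) i = if (N <= i)%N then f (i - N)%N else 0.
Proof.
rewrite p1_coefM; case: leqP => Ni.
  have Nlt : (N < i.+1)%N by rewrite ltnS.
  rewrite (bigD1 (Ordinal Nlt)) //= eqxx mul1r big1 ?addr0 // => j /eqP jN.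
  by case: eqP => [e|_]; [case: jN; apply: val_inj | rewrite mul0r].
apply: big1 => j _ /=; case: eqP => [e|_]; last by rewrite mul0r.
by move: (ltn_ord j); rewrite e ltnS leqNgt Ni.
Qed.

Lemma p1_mono0 : p1_mono A 0 = 1.
Proof. by apply: p1_ext. Qed.

Lemma p1_monoS N : p1_mono A N.+1 = p1_mono A 1 * p1_mono A N.
Proof. by apply: p1_ext => i; rewrite p1_monoE /=; case: i => // i; rewrite subn1. Qed.

Definition p1_trunc (N : nat) (f : poly1 A) : poly1 A :=
  \sum_(0 <= k < N) p1_const (f k) * p1_mono A k.

Lemma p1_truncE N (f : poly1 A) i : p1_trunc N f i = if (i < N)%N then f i else 0.
Proof.
rewrite /p1_trunc; elim: N => [|N IH]; first by rewrite big_geq // p1_coef0.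
rewrite big_nat_recr // p1_coefD IH p1_const_mulE /= ltnS.
by case: ltngtP => [||->]; rewrite ?mulr0 ?addr0 ?mulr1 ?add0r.
Qed.

Lemma p1_truncK N (f : poly1 A) : (forall i, (N <= i)%N -> f i = 0) -> p1_trunc N f = f.
Proof. by move=> fN; apply: p1_ext => i; rewrite p1_truncE; case: ltnP => // /fN. Qed.

Lemma p1_hom_eq (g h : {rmorphism poly1 A -> B}) :
  (forall a, g (p1_const a) = h (p1_const a)) -> g (p1_mono A 1) = h (p1_mono A 1) ->
  forall f, g f = h f.
Proof.
move=> eC eX f; have [N /p1_truncK <-] := p1_fin f.
rewrite !rmorph_sum /=; apply: eq_bigr => k _; rewrite !rmorphM eC; congr (_ * _).
elim: k => [|m IH]; first by rewrite p1_mono0 !rmorph1.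
by rewrite p1_monoS !rmorphM eX IH.
Qed.

Variable phi : {rmorphism A -> B}.

Definition p1_map (f : poly1 A) : poly1 B.
Proof.
exists (fun i => phi (f i)).
by have [N h] := p1_fin f; exists N => i /h ->; rewrite rmorph0.
Defined.

Fact p1_map_zmod : zmod_morphism p1_map.
Proof. by move=> f g; apply: p1_ext => i; apply: rmorphB. Qed.

Fact p1_map_monoid : monoid_morphism p1_map.
Proof.
split=> [|f g]; apply: p1_ext => i.
  by rewrite /=; case: ifP; rewrite ?rmorph0 ?rmorph1.
by rewrite /= rmorph_sum; apply: eq_bigr => j _; rewrite rmorphM.
Qed.

HB.instance Definition _ := GRing.isZmodMorphism.Build (poly1 A) (poly1 B) p1_map p1_map_zmod.
HB.instance Definition _ := GRing.isMonoidMorphism.Build (poly1 A) (poly1 B) p1_map p1_map_monoid.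

Lemma p1_map_const a : p1_map (p1_const a) = p1_const (phi a).
Proof. by apply: p1_ext => i /=; case: ifP; rewrite ?rmorph0. Qed.

Lemma p1_map_mono N : p1_map (p1_mono A N) = p1_mono B N.
Proof. by apply: p1_ext => i /=; case: ifP; rewrite ?rmorph0 ?rmorph1. Qed.

Variable c : B.

(** The bound on the support is taken from an existence proof; p1_evalE shows that
   any other bound gives the same value. *)
Definition p1_eval (f : poly1 A) : B :=
  \sum_(k < projT1 (cid (p1_fin f))) phi (f k) * c ^+ k.

Lemma p1_evalE N (f : poly1 A) : (forall i, (N <= i)%N -> f i = 0) ->
  p1_eval f = \sum_(k < N) phi (f k) * c ^+ k.
Proof.
rewrite /p1_eval; case: (cid _) => M hM /= hN.
have h K L : (forall i, (K <= i)%N -> f i = 0) -> (K <= L)%N ->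
    \sum_(k < K) phi (f k) * c ^+ k = \sum_(k < L) phi (f k) * c ^+ k.
  move=> hK KL; rewrite (big_ord_widen L (fun k => phi (f k) * c ^+ k)) //.
  rewrite [RHS](bigID (fun k : 'I_L => (k < K)%N)) /= [X in _ + X]big1 ?addr0 // => k.
  by rewrite -leqNgt => /hK->; rewrite rmorph0 mul0r.
by rewrite (h M (maxn M N)) ?leq_maxl // (h N (maxn M N)) ?leq_maxr.
Qed.

Fact p1_eval_zmod : zmod_morphism p1_eval.
Proof.
move=> f g; have [N hN] := p1_fin f; have [M hM] := p1_fin g.
have fN i : (maxn N M <= i)%N -> f i = 0 by rewrite geq_max => /andP[/hN].
have gN i : (maxn N M <= i)%N -> g i = 0 by rewrite geq_max => /andP[_ /hM].
rewrite (p1_evalE fN) (p1_evalE gN) (@p1_evalE (maxn N M)) -?sumrB.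
  by apply: eq_bigr => k _; rewrite p1_coefB rmorphB mulrBl.
by move=> i hi; rewrite p1_coefB fN // gN // subr0.
Qed.

HB.instance Definition _ := GRing.isZmodMorphism.Build (poly1 A) B p1_eval p1_eval_zmod.

Lemma p1_eval_constM a f : p1_eval (p1_const a * f) = phi a * p1_eval f.
Proof.
have [N hN] := p1_fin f; rewrite (p1_evalE hN) (@p1_evalE N) => [|i hi].
  by rewrite mulr_sumr; apply: eq_bigr => k _; rewrite p1_const_mulE rmorphM mulrA.
by rewrite p1_const_mulE hN // mulr0.
Qed.

Lemma p1_eval_monoM N f : p1_eval (p1_mono A N * f) = c ^+ N * p1_eval f.
Proof.
elim: N => [|N IH]; first by rewrite p1_mono0 !mul1r.
rewrite p1_monoS -mulrA exprS -mulrA -IH; set g := _ * f.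
have [M hM] := p1_fin g; rewrite (p1_evalE hM) (@p1_evalE M.+1) => [|i hi].
  rewrite big_ord_recl p1_monoE rmorph0 mul0r add0r mulr_sumr.
  by apply: eq_bigr => k _; rewrite p1_monoE /= subn1 exprS mulrCA.
by rewrite p1_monoE; case: i hi => // i hi; rewrite hM // subn1.
Qed.

(** By additivity, multiplicativity needs checking only when the first factor is a
   monomial, where it follows from shifting the coefficients. *)
Fact p1_eval_monoid : monoid_morphism p1_eval.
Proof.
split.
  rewrite (@p1_evalE 1) => [|[]//].
  by rewrite big_ord1 /= rmorph1 expr0 mulr1.
move=> f g; have [N hN] := p1_fin f; rewrite (p1_evalE hN).
rewrite -{1}(p1_truncK hN) /p1_trunc big_mkord !mulr_suml /= raddf_sum; apply: eq_bigr => k _.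
by rewrite -mulrA [LHS]p1_eval_constM p1_eval_monoM mulrA.
Qed.

HB.instance Definition _ := GRing.isMonoidMorphism.Build (poly1 A) B p1_eval p1_eval_monoid.

Lemma p1_eval_const a : p1_eval (p1_const a) = phi a.
Proof. by rewrite -[p1_const a]mulr1 p1_eval_constM rmorph1 mulr1. Qed.

Lemma p1_eval_X : p1_eval (p1_mono A 1) = c.
Proof. by rewrite -[p1_mono A 1]mulr1 p1_eval_monoM rmorph1 mulr1 expr1. Qed.

End Poly1Maps.

Section PolynMaps.

Fixpoint polyn_map (n : nat) (A B : comPzRingType) (phi : {rmorphism A -> B}) :
    {rmorphism polyn n A -> polyn n B} :=
  match n return {rmorphism polyn n A -> polyn n B} with
  | 0%N => phi
  | m.+1 => p1_map (polyn_map m phi)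
  end.

Lemma polyn_map_C n (A B : comPzRingType) (phi : {rmorphism A -> B}) a :
  polyn_map n phi (polyC n A a) = polyC n B (phi a).
Proof. by elim: n => //= n IH; rewrite p1_map_const IH. Qed.

Lemma polyn_map_comp n (A B C : comPzRingType) (phi : {rmorphism A -> B})
    (psi : {rmorphism B -> C}) (chi : {rmorphism A -> C}) :
  (forall a, psi (phi a) = chi a) ->
  forall f, polyn_map n psi (polyn_map n phi f) = polyn_map n chi f.
Proof. by move=> e; elim: n => //= n IH f; apply: p1_ext => i; exact: IH. Qed.

Lemma polyn_map_inj n (A B : comPzRingType) (phi : {rmorphism A -> B}) :
  injective phi -> injective (polyn_map n phi).
Proof.
move=> inj; elim: n => //= n IH f g e; apply: p1_ext => i; apply: IH.
exact: (congr1 (fun h : poly1 _ => h i) e).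
Qed.

(** A lift is determined by lifts of the images of the variables, and any choice
   of these works.  Formal smoothness is the case of a square-zero kernel. *)
Lemma polyn_lift n (A C D : comPzRingType) (phi : {rmorphism A -> C})
    (pi : {rmorphism C -> D}) (g : {rmorphism polyn n A -> D}) :
  (forall d, exists c, pi c = d) -> (forall a, g (polyC n A a) = pi (phi a)) ->
  exists h : {rmorphism polyn n A -> C},
    (forall a, h (polyC n A a) = phi a) /\ (forall f, pi (h f) = g f).
Proof.
move=> su; elim: n g => [|n IH] g e; first by exists phi; split=> // a; rewrite -e.
have [h [hC hg]] := IH (g \o @p1_const _) e.
have [c ec] := su (g (p1_mono _ 1)).
exists (p1_eval h c); split=> [a|f]; first by rewrite /= p1_eval_const.
apply: (p1_hom_eq (g := pi \o p1_eval h c)) => [a|] /=; first by rewrite p1_eval_const hg.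
by rewrite p1_eval_X.
Qed.

(** A'[t] is the base change of A[t] along alpha. *)
Lemma polyn_pushout n (A A' L : comPzRingType) (alpha : {rmorphism A -> A'})
    (delta : {rmorphism polyn n A -> L}) (sigma : {rmorphism A' -> L}) :
  (forall a, sigma (alpha a) = delta (polyC n A a)) ->
  exists h : {rmorphism polyn n A' -> L}, (forall a, h (polyC n A' a) = sigma a) /\
    (forall f, h (polyn_map n alpha f) = delta f).
Proof.
elim: n delta => [|n IH] delta e; first by exists sigma; split.
have [h [hC hd]] := IH (delta \o @p1_const _) e.
exists (p1_eval h (delta (p1_mono _ 1))); split=> [a|f]; first by rewrite /= p1_eval_const.
apply: (p1_hom_eq (g := p1_eval h _ \o polyn_map n.+1 alpha)) => [a|] /=.
  by rewrite p1_map_const p1_eval_const hd.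
by rewrite p1_map_mono p1_eval_X.
Qed.

(** The condition is checked coefficientwise: a polynomial has finitely many
   coefficients, so that their multipliers have a common multiple. *)
Lemma frac_iso_p1_map (A B : comPzRingType) (S : mulset A) (phi : {rmorphism A -> B}) :
  frac_iso S phi -> frac_iso (ms_image (@p1_const A) S) (p1_map phi).
Proof.
move=> [su inj].
have common (P : nat -> A -> Prop) :
    (forall i s t, P i s -> P i (t * s)) -> (forall i, exists2 s, S s & P i s) ->
    forall N, exists2 s, S s & forall i, (i < N)%N -> P i s.
  move=> PM ex; elim=> [|N [s Ss hs]]; first by exists 1; [exact: ms_one|].
  have [t St ht] := ex N; exists (t * s); first exact: ms_mul.
  move=> i; rewrite ltnS leq_eqVlt => /orP[/eqP->|/hs]; last exact: PM.
  by rewrite mulrC; apply: PM.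
split=> [f|f f0].
  have [N hN] := p1_fin f.
  have [|i|s Ss hs] := common (fun i s => exists a, phi s * f i = phi a) _ _ N.
  - by move=> i s t [a e]; exists (t * a); rewrite !rmorphM -e mulrA.
  - by have [s] := su (f i); exists s.
  have ex i : exists a, phi s * f i = phi a /\ ((N <= i)%N -> a = 0).
    have [iN|iN] := ltnP i N; first by have [a] := hs i iN; exists a.
    by exists 0; rewrite hN // mulr0 rmorph0.
  have [a ha] := choice ex; exists (p1_const s); first by exists s.
  have fin : exists M, forall i, (M <= i)%N -> a i = 0 by exists N => i; case: (ha i).
  exists (Poly1 fin); rewrite [X in X * _]p1_map_const; apply: p1_ext => i.
  by rewrite p1_const_mulE; case: (ha i).
have [N hN] := p1_fin f.
have [|i|s Ss hs] := common (fun i s => s * f i = 0) _ _ N.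
- by move=> i s t e; rewrite -mulrA e mulr0.
- apply: inj; have := congr1 (fun g : poly1 _ => g i) f0.
  by rewrite p1_coef0.
exists (p1_const s); first by exists s.
apply: p1_ext => i; rewrite p1_const_mulE p1_coef0.
by have [/hs|/hN->] := ltnP i N; rewrite ?mulr0.
Qed.

Lemma frac_iso_polyn_map n (A B : comPzRingType) (S : mulset A) (phi : {rmorphism A -> B}) :
  frac_iso S phi -> frac_iso (ms_image (polyC n A) S) (polyn_map n phi).
Proof.
move=> iso; elim: n => [|n /frac_iso_p1_map].
  by apply: frac_iso_sub iso => s Ss; exists s.
by apply: frac_iso_sub => _ [_ [s Ss ->] ->]; exists s.
Qed.

Lemma smooth_polyC n (A : comPzRingType) : smooth (polyC n A).
Proof.
split.
  exists n, idfun, [::]; split=> // [b|f]; first by exists b.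
  split=> [/= ->|]; first by have [] := ideal_gen_ideal [set` [::] : seq (polyn n A)].
  apply: (@ideal_gen_min _ _ [set 0]) => //.
  split=> // [x y -> ->|a x ->] /=; first by rewrite addr0.
  by rewrite mulr0.
move=> C D iota pi g su _ e.
have [h [hC hg]] := polyn_lift su e.
by exists h.
Qed.

Lemma essentially_smooth_to_gauss n (R : comPzRingType) :
  essentially_smooth (to_gauss n R).
Proof.
exists (polyn n R), (polyC n R); split; first exact: smooth_polyC.
by exists (gauss_mulset n R), idfun; split=> //; exists id.
Qed.

Lemma ideal_polynC n (R : comPzRingType) (p : spec R) a :
  ideal_polyn n p (polyC n R a) <-> p a.
Proof.
split=> [|pa]; last by apply: ideal_gen_sub; exists a.
elim: n => [|n IH].
  by apply: (@ideal_gen_min _ _ p); [exact: sp_ideal | move=> _ [x px <-]].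
rewrite ideal_polynS => /(ideal_p1P _ (ideal_gen_ideal _))/(_ 0%N).
exact: IH.
Qed.

(** U avoids the prime p R[t], which therefore survives in R(t); it contracts to p
   because its constant polynomials are those of p. *)
Lemma to_gauss_spec_surjective n (R : comPzRingType) (p : spec R) :
  exists q : spec (gauss n R), spec_map (to_gauss n R) q = p.
Proof.
have [q qE] := ideal_polyn_prime n p.
have [q' q'E] : exists q', spec_map (to_loc (gauss_mulset n R)) q' = q.
  apply: frac_iso_prime_lift (frac_iso_to_loc _) _ => s /(_ p).
  by rewrite -qE.
exists q'; apply: sp_ext => a.
by have := ideal_polynC n p a; rewrite -qE -q'E.
Qed.

End PolynMaps.

(** * Maps that are isomorphisms over basic open sets *)

Lemma frac_irr (A : comPzRingType) (S : mulset A) a s (h k : S s) : frac a h = frac a k.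
Proof. by congr frac; apply: Prop_irrelevance. Qed.

Section OpenImmersion.
Variables (B D : comPzRingType) (psi : {rmorphism B -> D}) (E : set B).

(** The basic open sets D(f), for f in E, are covered isomorphically by those
   D(psi f) over them, and the latter cover the spectrum of D.  This is an
   algebraic form of the statement that Spec D is the open subscheme of Spec B
   that is the union of the D(f); unlike the geometric one, it passes directly to
   polynomial rings and to rings of fractions. *)
Definition iso_on_basic_cover : Prop :=
  (forall f, E f -> frac_iso (powers f) psi) /\
  (forall q : spec D, exists2 f, E f & ~ q (psi f)).

Hypothesis cover : iso_on_basic_cover.

Lemma cover_prime (q : spec D) : exists2 S : mulset B, frac_iso S psi &
  exists f, [/\ E f, ~ q (psi f), S = powers f & forall s, S s -> ~ q (psi s)].
Proof.
have [iso cov] := cover; have [f Ef qf] := cov q.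
exists (powers f); first exact: iso.
by exists f; split=> // _ [m ->]; rewrite rmorphXn; apply: primeX.
Qed.

(** If s d = psi b for some s outside the prime q, then d is in q exactly when b
   is in the contraction of q. *)
Lemma cover_spec_map_inj : injective (spec_map psi).
Proof.
move=> q q' e; have [S [su _] [f [Ef qf SE qS]]] := cover_prime q.
have memE b : q (psi b) <-> q' (psi b).
  by rewrite -[q (psi b)]/(spec_map psi q b) e.
have q'S s : S s -> ~ q' (psi s) by move=> /qS qs /memE.
apply: sp_ext => d; have [s Ss [b eb]] := su d.
have qE (r : spec D) : (forall t, S t -> ~ r (psi t)) -> r d <-> r (psi b).
  move=> rS; rewrite -eb; split; first exact: primeM.
  by case/sp_prime => // /(rS s Ss).
by rewrite (qE q qS) (qE q' q'S); exact: memE.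
Qed.

Lemma cover_range (p : spec B) :
  (exists q, spec_map psi q = p) <-> (exists2 f, E f & ~ p f).
Proof.
have [iso cov] := cover; split=> [[q <-]|[f Ef pf]]; first exact: cov.
exact: frac_iso_prime_lift (iso f Ef) (fun s => powers_prime pf (s := s)).
Qed.

(** The image of D(d) is the union of the D(f b), for f in E and b with
   psi (f ^+ m) * d = psi b. *)
Lemma cover_spec_map_open (W : set (spec D)) : open W -> open (spec_map psi @` W).
Proof.
case=> G ->; have [iso cov] := cover.
exists [set h | exists f b d s, [/\ E f, G d, powers f s, psi s * d = psi b & h = f * b]].
apply/seteqP; split=> p /=.
  move=> [q /existsNP[d /not_implyP[Gd qd]] <-].
  have [f Ef qf] := cov q; have [s Ss [b eb]] := (iso f Ef).1 d.
  move=> /(_ (f * b)) h; have /sp_prime[] : spec_map psi q (f * b).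
  - by apply: h; exists f, b, d, s.
  - exact: qf.
  - have qs : ~ q (psi s) by case: Ss => m ->; rewrite rmorphXn; apply: primeX.
    by rewrite /= -eb => /sp_prime[].
move=> /existsNP[_ /not_implyP[[f [b [d [s [Ef Gd Ss eb ->]]]]] pfb]].
have pf : ~ p f by move=> pf; apply: pfb; rewrite mulrC; apply: primeM.
have [q qp] : exists q, spec_map psi q = p by apply/cover_range; exists f.
exists q => // /(_ d Gd) qd; apply: pfb; apply: primeM.
by rewrite -qp /= -eb; apply: primeM.
Qed.

(** A multiplier that equates the images of two fractions can itself be replaced by
   an element of B. *)
Lemma cover_stalk_inj (q : spec D) : injective (loc_at_map psi q).
Proof.
have [S iso [f [_ _ _ qS]]] := cover_prime q.
elim/locP => a s qs; elim/locP => b t qt.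
rewrite [LHS]loc_mapE [RHS]loc_mapE => /frac_eq[u qu e].
have [v Sv [w ew]] := iso.1 u.
have [|z Sz ez] := frac_iso_ker iso (a := w * (a * t)) (b := w * (b * s)).
  by rewrite [LHS]rmorphM [RHS]rmorphM -ew -!mulrA !rmorphM e.
apply/frac_eq; exists (z * w); last by rewrite -!mulrA.
apply: primeNM; first exact: qS.
rewrite /= -ew; apply: primeNM => //; exact: qS.
Qed.

(** A local fraction c / d over Spec D can be rewritten with numerator and
   denominator from B; since the map on spectra is open and injective, it is then
   valid on the full preimage of an open subset of Spec B. *)
Lemma cover_section_frac (V : opens (spec B))
    (t : spec_sec (op_preim (@spec_map_continuous _ _ psi) V)) (q : spec D)
    (Vq : V (spec_map psi q)) :
  exists (N : opens (spec B)) (a b : B), [/\ N (spec_map psi q), op_le N V &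
    forall q' (Vq' : V (spec_map psi q')), N (spec_map psi q') ->
      exists hb : sp_compl q' (psi b), t q' Vq' = frac (psi a) hb].
Proof.
have [S iso [f [Ef qf SE qS]]] := cover_prime q.
have [W [Wq [WV [c [d e]]]]] := ss_loc t Vq.
have [s Ss [a ea]] := iso.1 c; have [s' Ss' [b eb]] := iso.1 d.
pose W' := op_cap W (basic_open (psi f)).
exists (Opens (cover_spec_map_open (op_open W'))), (s' * a), (s * b).
split; first by exists q.
  by move=> _ [q' [Wq' _] <-]; apply: (WV q' Wq').
move=> q' Vq' [q'' [Wq'' qf''] /cover_spec_map_inj eq]; subst q''.
have q'S r : S r -> ~ q' (psi r).
  by rewrite SE => -[m ->]; rewrite rmorphXn; apply: primeX.
have [dq'] := e q' Wq''; rewrite (Prop_irrelevance (WV q' Wq'') Vq') => ->.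
have hb : sp_compl q' (psi (s * b)).
  rewrite /= rmorphM -eb; apply: primeNM; first exact: q'S.
  by apply: primeNM => //; apply: q'S.
exists hb; apply/frac_eq; exists 1; first exact: ms_one.
by rewrite !mul1r !rmorphM -ea -eb; ring.
Qed.

(** A section t over the preimage of V descends pointwise: its value at p is the
   image of a fraction a / b from cover_section_frac, unique by cover_stalk_inj. *)
Lemma cover_open_immersion : open_immersion (Spec_ringed_mor psi).
Proof.
split; [exact: cover_spec_map_inj | exact: cover_spec_map_open|].
move=> V Vran.
have inj : injective (@ss_pull _ _ psi V).
  move=> s t e; apply: ss_ext => p Vp; have [q _ qp] := Vran p Vp; subst p.
  apply: (@cover_stalk_inj q).
  by have := congr1 (fun r : spec_sec (op_preim (@spec_map_continuous _ _ psi) V) => r q Vp) e.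
suff su t : exists s, @ss_pull _ _ psi V s = t.
  have [k kP] := choice su.
  by exists k => s; [apply: inj; rewrite kP | exact: kP].
have ex p (Vp : V p) : exists z : loc (sp_compl p), exists a b (pb : sp_compl p b),
    z = frac a pb /\ forall q (Vq : V (spec_map psi q)), spec_map psi q = p ->
      exists hb : sp_compl q (psi b), t q Vq = frac (psi a) hb.
  have [q _ qp] := Vran p Vp; subst p.
  have [N [a [b [Nq NV h]]]] := cover_section_frac t Vp.
  have [hb _] := h q Vp Nq.
  exists (@frac B (sp_compl (spec_map psi q)) a b hb), a, b, hb; split=> // q' Vq' e.
  by apply: h; rewrite [spec_map _ _]e.
(* the descended section *)
pose v p Vp := projT1 (cid (ex p Vp)).
have vE p Vp a b (pb : sp_compl p b) : (forall q (Vq : V (spec_map psi q)),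
    spec_map psi q = p -> exists hb : sp_compl q (psi b), t q Vq = frac (psi a) hb) ->
    v p Vp = frac a pb.
  move=> h; rewrite /v; case: (cid _) => z /= [a' [b' [pb' [-> h']]]].
  have [q _ qp] := Vran p Vp; subst p.
  have [hb e] := h q Vp erefl; have [hb' e'] := h' q Vp erefl.
  apply: cover_stalk_inj; rewrite [LHS]loc_mapE [RHS]loc_mapE.
  apply: etrans (etrans (etrans (esym e') e) _); exact: (@frac_irr _ (sp_compl q)).
have vloc p : V p -> exists W : opens (spec B), W p /\
    exists (WV : op_le W V) (a g : B), forall r (Wr : W r),
    exists gr : sp_compl r g, v r (WV r Wr) = frac a gr.
  move=> Vp; have [q _ qp] := Vran p Vp; subst p.
  have [N [a [b [Nq NV h]]]] := cover_section_frac t Vp.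
  exists N; split=> //; exists NV, a, b => r Nr.
  have [q' _ qr] := Vran r (NV r Nr); subst r.
  have [hb _] := h q' (NV _ Nr) Nr.
  exists hb; apply: vE => q'' Vq'' e; apply: h; rewrite e; exact: Nr.
exists (SpecSec vloc); apply: ss_ext => q Vq /=.
rewrite /v; case: (cid _) => z /= [a [b [pb [-> h]]]].
have [hb ->] := h q Vq erefl; rewrite [LHS]loc_mapE.
exact: frac_irr.
Qed.

End OpenImmersion.

(** * Affine open subsets of a spectrum *)

Section ConstantSections.
Variables (A : comPzRingType) (U : opens (spec A)).

Fact ss_const_zmod : zmod_morphism (@ss_const A U).
Proof. by move=> a b; apply: ss_ext => p Up; apply: rmorphB. Qed.

Fact ss_const_monoid : monoid_morphism (@ss_const A U).
Proof. by split=> [|a b]; apply: ss_ext => p Up; [apply: rmorph1 | apply: rmorphM]. Qed.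

HB.instance Definition _ :=
  GRing.isZmodMorphism.Build A (spec_sec U) (@ss_const A U) ss_const_zmod.
HB.instance Definition _ :=
  GRing.isMonoidMorphism.Build A (spec_sec U) (@ss_const A U) ss_const_monoid.

Definition const_sec : {rmorphism A -> spec_sec U} := @ss_const A U.

Lemma const_secE a p (Up : U p) : const_sec a p Up = to_loc (sp_compl p) a.
Proof. by []. Qed.

Lemma const_sec_bij : (forall p, U p) -> bijective const_sec.
Proof.
move=> full.
have Uf (p : spec A) : U p <-> ~ p 1 by split=> // _; apply: sp_proper.
have inj : injective const_sec.
  move=> a b e; have [|m] := @basic_open_vanish A 1 (a - b).
    move=> p _; have := congr1 (fun s : spec_sec U => s p (full p)) e.
    rewrite !const_secE => ab; rewrite rmorphB; apply/eqP; rewrite subr_eq0; exact/eqP.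
  by rewrite expr1n mul1r => /eqP; rewrite subr_eq0 => /eqP.
suff su s : exists a, const_sec a = s.
  have [k kP] := choice su.
  by exists k => a; [apply: inj; rewrite kP | exact: kP].
have [m [a h]] := basic_open_section s Uf.
exists a; apply: ss_ext => p Up.
by rewrite const_secE -(h p Up) expr1n rmorph1 mul1r.
Qed.

End ConstantSections.

Lemma bij_factor (A B C : comPzRingType) (alpha : {rmorphism A -> C})
    (beta : {rmorphism B -> C}) : bijective alpha -> bijective beta ->
  exists e : {rmorphism A -> B}, bijective e /\ forall a, beta (e a) = alpha a.
Proof.
move=> [alpha' aK a'K] [beta' bK b'K].
pose e a := beta' (alpha a).
have eE a : beta (e a) = alpha a by apply: b'K.
have inj := can_inj bK.
have eZ : zmod_morphism e by move=> x y; apply: inj; rewrite rmorphB !eE rmorphB.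
have eM : monoid_morphism e.
  by split=> [|x y]; apply: inj; rewrite ?rmorphM !eE ?rmorph1 ?rmorphM.
pose hZ := GRing.isZmodMorphism.Build A B e eZ.
pose hM := GRing.isMonoidMorphism.Build A B e eM.
pose ee : {rmorphism A -> B} := HB.pack e hZ hM.
exists ee; split=> //; exists (fun b => alpha' (beta b)) => x /=.
  by rewrite eE aK.
by rewrite /e a'K bK.
Qed.

Section AffineOpen.
Variables (R C : comPzRingType) (j : ringed_mor (Spec C) (Spec R)) (V : opens (spec R)).
Hypotheses (j_open : open_immersion j) (j_range : range j = op_set V).

Let jV x : V (j x).
Proof. by rewrite -[V _]/(op_set V _) -j_range; exists x. Qed.

(** The sections over V are those over Spec C, that is, C itself. *)
Lemma affine_sections : exists rho : {rmorphism C -> spec_sec V},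
  bijective rho /\ forall c, rm_sharp j V (rho c) = const_sec _ c.
Proof.
have [_ _ /(_ V) bijV] := j_open.
apply: (@bij_factor C (spec_sec V) _ (const_sec _) (rm_sharp j V)).
  exact: const_sec_bij.
by apply: bijV; rewrite j_range.
Qed.

Variable rho : {rmorphism C -> spec_sec V}.
Hypotheses (rho_bij : bijective rho)
  (rhoE : forall c, rm_sharp j V (rho c) = const_sec _ c).

Lemma inv_sec (A : comPzRingType) (W : opens (spec A)) (p : spec A) a : W p -> ~ p a ->
  exists2 Z : opens (spec A), Z p /\ op_le Z W &
    exists t : spec_sec Z, t * const_sec Z a = 1.
Proof.
move=> Wp pa; have [Z Zp [ZW [t te]]] := spec_inv_sec 1 Wp pa.
exists Z => //; exists t; apply: ss_ext => q Zq.
have [aq e] := te q Zq.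
rewrite -[LHS]/(t q Zq * const_sec Z a q Zq) e const_secE mulrC to_locM_frac.
by [].
Qed.

Lemma inv_sec_point (A : comPzRingType) (W : opens (spec A)) (p : spec A) a
    (s : spec_sec W) : W p -> s * const_sec W a = 1 -> ~ p a.
Proof.
move=> Wp /(congr1 (fun r : spec_sec W => r p Wp)).
rewrite -[LHS]/(s p Wp * to_loc (sp_compl p) a) -[RHS]/(to_loc (sp_compl p) 1).
elim/locP: (s p Wp) => b c pc; rewrite fracM => /frac_eq[u pu e] pa.
have : p (u * (1 * (c * 1))) by rewrite -e mulr1; do ![apply: primeM].
by rewrite mul1r mulr1 => /sp_prime[].
Qed.

Lemma res_const (W W' : opens (spec R)) (h : op_le W' W) a :
  ss_res h (const_sec W a) = const_sec W' a.
Proof. exact: ss_ext. Qed.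

(** An element is invertible at a point exactly when it has an inverse section near
   that point; such sections pass along j in both directions, as j is an
   isomorphism onto an open subset.  In other words j is a morphism of locally
   ringed spaces. *)
Lemma affine_basic_open f c : rho c = const_sec V f ->
  forall x : spec C, x c <-> (j x : spec R) f.
Proof.
move=> cf x; have [jinj jopen jbij] := j_open; split; apply: contraPP => nf.
  have [Z [Zjx ZV] [t te]] := inv_sec (jV x) nf.
  apply: (@inv_sec_point C (op_preim (rm_cont j) Z) x c (rm_sharp j Z t)) => //.
  rewrite -(rmorph1 (rm_sharp j Z)) -te rmorphM; congr (_ * _).
  transitivity (rm_sharp j Z (rs_res (r := Spec R) ZV (const_sec V f))); last first.
    by congr (rm_sharp j Z _); apply: res_const.
  by rewrite -rm_nat -cf rhoE; apply: ss_ext.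
have [Z [Zx _] [t te]] := inv_sec (W := op_full (spec C)) I nf.
have oN : open (j @` Z) by apply: jopen; apply: op_open.
pose N : opens (spec R) := Opens oN.
have NV : op_le N V by move=> _ [y _ <-].
have ZN : op_le (op_preim (rm_cont j) N) Z by move=> y [z Zz /jinj<-].
have [|k kK kK'] := jbij N; first by move=> _ [y _ <-]; exists y.
pose s : spec_sec N := k (ss_res ZN t).
have Njx : N (j x) by exists x.
apply: (inv_sec_point (s := s) Njx).
apply: (can_inj kK); rewrite rmorphM rmorph1 kK'.
transitivity (ss_res ZN (t * const_sec Z c)); last by rewrite te rmorph1.
rewrite rmorphM; congr (_ * _).
transitivity (rm_sharp j N (rs_res (r := Spec R) NV (const_sec V f))).
  by congr (rm_sharp j N _); symmetry; apply: res_const.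
by rewrite -rm_nat -cf rhoE; apply: ss_ext.
Qed.

(** Affineness enters twice.  Through affine_basic_open, each prime of the ring of
   sections over V comes from a point of V, and so avoids some f with D(f) in V.
   And a section over V that vanishes on D(f) is an element of C that vanishes on
   a basic open set of Spec C, so that a power of f kills it. *)
Lemma affine_open_cover :
  iso_on_basic_cover (const_sec V) [set f | op_le (basic_open f) V].
Proof.
have [rho' rhoK rho'K] := rho_bij.
have vanish (f : R) (z : spec_sec V) : (forall p (Vp : V p), ~ p f -> z p Vp = 0) ->
    op_le (basic_open f) V -> exists m, const_sec V f ^+ m * z = 0.
  move=> z0 fV.
  have [|m e] := @basic_open_vanish C (rho' (const_sec V f)) (rho' z).
    move=> x xf; have jxf : ~ (j x : spec R) f.
      by move=> h; apply: xf; apply/(affine_basic_open (rho'K _)).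
    have zW : rs_res (r := Spec R) fV z = 0.
      by apply: ss_ext => p pf; apply: z0.
    have := rm_nat j fV z; rewrite zW rmorph0 -[in LHS](rho'K z) rhoE.
    exact: (congr1 (fun s : spec_sec (op_preim (rm_cont j) (basic_open f)) => s x jxf)).
  by exists m; rewrite -[z]rho'K -[const_sec V f]rho'K -rmorphXn -rmorphM e rmorph0.
split=> [f fV|q].
  split=> [s|a a0].
    have [|m [a ha]] := @basic_open_section R f (basic_open f) (ss_res fV s); first by [].
    have [|k ek] := vanish f (const_sec V (f ^+ m) * s - const_sec V a) _ fV.
      move=> p Vp pf; rewrite -[LHS]/(to_loc (sp_compl p) (f ^+ m) * s p Vp - to_loc _ a).
      have := ha p pf; rewrite /= (Prop_irrelevance (fV p pf) Vp) => ->.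
      by rewrite subrr.
    exists (f ^+ (k + m)); first by exists (k + m)%N.
    exists (f ^+ k * a); apply/eqP; rewrite -subr_eq0; apply/eqP.
    by rewrite -ek exprD !rmorphM !rmorphXn; ring.
  have [|m e] := @basic_open_vanish R f a.
    move=> p pf; have Vp := fV p pf.
    exact: (congr1 (fun s : spec_sec V => s p Vp) a0).
  by exists (f ^+ m) => //; exists m.
have [f jf fV] := basic_open_nbhs (jV (spec_map rho q)).
exists f => // qf; apply: jf; apply/(affine_basic_open (rho'K _)).
by rewrite /= rho'K.
Qed.

End AffineOpen.

(** * The preimage of an affine open subset *)

(** If s = r / a near a point, then a s = r determines the value of s there, and
   psi (phi a) * d = psi (phi r) determines that of d in the same way. *)
Lemma ss_pull_pull_const (A B D : comPzRingType) (phi : {rmorphism A -> B})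
    (psi : {rmorphism B -> D}) (V : opens (spec A)) (s : spec_sec V) (d : D) :
  (forall p : spec A, V p -> exists a r, [/\ ~ p a, const_sec V a * s = const_sec V r &
     psi (phi a) * d = psi (phi r)]) ->
  ss_pull psi (ss_pull phi s) = const_sec _ d.
Proof.
move=> h; apply: ss_ext => y Vy.
pose p := spec_map phi (spec_map psi y); pose Vp : V p := Vy.
have [a [r [pa er ed]]] := h p Vp.
have sp : s p Vp = @frac A (sp_compl p) r a pa.
  apply: (unit_cancel (to_loc_unit (S := sp_compl p) pa)).
  by rewrite [RHS]to_locM_frac; have := congr1 (fun t : spec_sec V => t p Vp) er.
rewrite const_secE -[LHS]/(loc_at_map psi y (loc_at_map phi (spec_map psi y) (s p Vp))).
rewrite sp [loc_at_map _ (spec_map psi y) _]loc_mapE [LHS]loc_mapE.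
apply/frac_eq; exists 1; first exact: ms_one.
by rewrite !mul1r mulr1 -ed mulrC.
Qed.

Section GaussPullback.
Variables (n : nat) (R : comPzRingType) (V : opens (spec R)).
Let f := Spec_mor (to_gauss n R).
Let kappa := const_sec V.
Let W : opens (spec (gauss n R)) := op_preim (rm_cont f) V.

Hypothesis cover : iso_on_basic_cover kappa [set a | op_le (basic_open a) V].

(* D is the tensor product of O(V) and R(t) over R: as a ring of fractions of
   O(V)[t] it is An-localising over O(V) by construction. *)
Let T := ms_image (polyn_map n kappa) (gauss_mulset n R).
Let D := loc T.

Fact gauss_pullback_mulset u : gauss_mulset n R u -> T (polyn_map n kappa u).
Proof. by exists u. Qed.

Let psi : {rmorphism gauss n R -> D} := loc_map gauss_pullback_mulset.
Let phi : {rmorphism spec_sec V -> D} := to_loc T \o polyC n (spec_sec V).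

Let psi_phi r : psi (to_gauss n R r) = phi (kappa r).
Proof.
rewrite [LHS]loc_mapE /= -polyn_map_C; apply/frac_eq; exists 1; first exact: ms_one.
by rewrite rmorph1.
Qed.

(** The isomorphisms away from the a survive the passage to polynomials and then to
   fractions.  A prime of D avoids some a since its contraction to O(V) does. *)
Lemma gauss_pullback_cover :
  iso_on_basic_cover psi (to_gauss n R @` [set a | op_le (basic_open a) V]).
Proof.
have [iso cov] := cover; split=> [_ [a aV <-]|q]; last first.
  have [a aV qa] := cov (spec_map phi q).
  by exists (to_gauss n R a); [exists a | rewrite psi_phi].
apply: frac_iso_sub (frac_iso_loc_map gauss_pullback_mulset
  (frac_iso_polyn_map n (iso a aV))) => _ [_ [_ [m ->] ->] ->].
by exists m; rewrite !rmorphXn.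
Qed.

Let g := Spec_ringed_mor psi.

Lemma gauss_pullback_range : range g = op_set W.
Proof.
apply/seteqP; split=> p.
  move=> [q _ qp]; have [|_ [a aV <-] pa] := (cover_range gauss_pullback_cover p).1.
    by exists q.
  by apply: aV.
move=> Wp; have [a pa aV] := @basic_open_nbhs R V (spec_map (to_gauss n R) p) Wp.
have [|q qp] := (cover_range gauss_pullback_cover p).2.
  by exists (to_gauss n R a) => //; exists a.
by exists q.
Qed.

Lemma gauss_pullback_affine : affine_open (X := Spec (gauss n R)) W.
Proof.
exists D, g; split; last exact: gauss_pullback_range.
exact: cover_open_immersion gauss_pullback_cover.
Qed.

(** The pullback of sections along f agrees with the structure map from O(V) to D:
   locally s = r / a with a s = r in O(V), so that both equal psi r / psi a. *)
Lemma gauss_pullback_sections (s : spec_sec V) :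
  rm_sharp g W (rm_sharp f V s) = const_sec _ (phi s).
Proof.
apply: ss_pull_pull_const => p Vp.
have [a pa aV] := basic_open_nbhs Vp.
have [t [m tE] [r er]] := (cover.1 a aV).1 s.
exists t, r; split=> //; first by rewrite tE; apply: primeX.
by rewrite !psi_phi -er rmorphM.
Qed.

Lemma gauss_pullback_An_localising : An_localising (rm_sharp f V) n.
Proof.
exists T.
have [_ _ /(_ W)] := cover_open_immersion gauss_pullback_cover.
rewrite -gauss_pullback_range => /(_ (fun _ h => h)) bijW.
have bijD : bijective (const_sec (op_preim (rm_cont g) W) : {rmorphism D -> _}).
  apply: const_sec_bij => q; rewrite -[op_preim _ _ _]/(op_set W (g q)).
  by rewrite -gauss_pullback_range; exists q.
have [e [be eE]] := bij_factor bijD bijW.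
exists e; split=> // s; apply: (bij_inj bijW); rewrite eE.
by rewrite [RHS]gauss_pullback_sections.
Qed.

End GaussPullback.

Lemma to_gauss_strongly_An_localising n (R : comPzRingType) :
  strongly_An_localising (Spec_mor (to_gauss n R)) n.
Proof.
have cov (V : opens (spec R)) : affine_open (X := Spec R) V ->
    iso_on_basic_cover (const_sec V) [set a | op_le (basic_open a) V].
  move=> [C [j [jo jr]]]; have [rho [bij rhoE]] := affine_sections jo jr.
  exact: affine_open_cover bij rhoE.
split=> V /cov; first exact: gauss_pullback_affine.
exact: gauss_pullback_An_localising.
Qed.

(** * Flatness of localised polynomial rings *)

Section TrivialExtension.
Variables (A : comPzRingType) (M : lmodType A).

(** The square-zero extension of A by M.  Since the polynomials over it form a ring
   containing M[t], tensors with values in M (x) A[t] and their localisations can be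
   evaluated in a commutative ring, with no separate theory of modules of
   polynomials and of fractions. *)
Definition trivext : Type := (A * M)%type.

HB.instance Definition _ := GRing.Zmodule.on trivext.

Definition te_one : trivext := (1, 0).
Definition te_mul (x y : trivext) : trivext := (x.1 * y.1, x.1 *: y.2 + y.1 *: x.2).

Fact te_mulA : associative te_mul.
Proof.
move=> x y z; rewrite /te_mul /= mulrA; congr (_, _).
by rewrite !scalerDr !scalerA -addrA (mulrC z.1) (mulrC z.1).
Qed.

Fact te_mulC : commutative te_mul.
Proof. by move=> x y; rewrite /te_mul mulrC addrC. Qed.

Fact te_mul1 : left_id te_one te_mul.
Proof. by case=> a m; rewrite /te_mul /= mul1r scale1r scaler0 addr0. Qed.

Fact te_mulD : left_distributive te_mul +%R.
Proof.
move=> x y z; rewrite /te_mul /= mulrDl scalerDl scalerDr; congr (_, _).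
by rewrite addrACA.
Qed.

HB.instance Definition _ :=
  GRing.Zmodule_isComPzRing.Build trivext te_mulA te_mulC te_mul1 te_mulD.

Definition te_alg (a : A) : trivext := (a, 0).

Fact te_alg_zmod : zmod_morphism te_alg.
Proof. by move=> a b; congr (_, _); rewrite subr0. Qed.

Fact te_alg_monoid : monoid_morphism te_alg.
Proof. by split=> // a b; congr (_, _); rewrite /= !scaler0 addr0. Qed.

HB.instance Definition _ := GRing.isZmodMorphism.Build A trivext te_alg te_alg_zmod.
HB.instance Definition _ := GRing.isMonoidMorphism.Build A trivext te_alg te_alg_monoid.

Definition te_mod (m : M) : trivext := (0, m).

Lemma te_mod0 : te_mod 0 = 0. Proof. by []. Qed.

Lemma te_modD m m' : te_mod (m + m') = te_mod m + te_mod m'.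
Proof. by congr (_, _); rewrite addr0. Qed.

Lemma te_modZ a m : te_mod (a *: m) = te_alg a * te_mod m.
Proof. by congr (_, _); rewrite /= ?mulr0 // scaler0 addr0. Qed.

End TrivialExtension.

Section TrivialExtensionMap.
Variables (A : comPzRingType) (M N : lmodType A) (u : {linear M -> N}).

Definition te_map (x : trivext M) : trivext N := (x.1, u x.2).

Fact te_map_zmod : zmod_morphism te_map.
Proof. by move=> x y; congr (_, _); rewrite /= linearB. Qed.

Fact te_map_monoid : monoid_morphism te_map.
Proof.
split=> [|x y]; first by congr (_, _); rewrite linear0.
by congr (_, _); rewrite /= linearD !linearZ.
Qed.

HB.instance Definition _ := GRing.isZmodMorphism.Build (trivext M) (trivext N) te_map te_map_zmod.
HB.instance Definition _ :=
  GRing.isMonoidMorphism.Build (trivext M) (trivext N) te_map te_map_monoid.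

Lemma te_map_alg a : te_map (te_alg M a) = te_alg N a.
Proof. by rewrite /te_map /= linear0. Qed.

Lemma te_map_inj : injective u -> injective te_map.
Proof. by move=> inj [a m] [b k] [-> /inj ->]. Qed.

End TrivialExtensionMap.

Section TensorCalculus.
Variables (A B : comPzRingType) (phi : {rmorphism A -> B}) (M : lmodType A).
Implicit Types s t : seq (M * B).

Lemma tensor_m0 (m : M) : tensor_eq phi [:: (m, 0)] [::].
Proof.
apply: TensorTrans (Tensor0 phi M 0); apply: TensorSym.
by have := TensorZ phi 0 m 0; rewrite scale0r mulr0.
Qed.

Lemma tensor_cons x s t : tensor_eq phi s t -> tensor_eq phi (x :: s) (x :: t).
Proof. by move=> e; have := TensorCat (TensorRefl phi [:: x]) e. Qed.

Lemma tensor_map0 s : tensor_eq phi [seq (x.1, 0) | x <- s] [::].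
Proof.
elim: s => [|x s IH] /=; first exact: TensorRefl.
exact: TensorTrans (tensor_cons _ IH) (tensor_m0 _).
Qed.

Lemma tensor_mapD (g h : B -> B) s :
  tensor_eq phi [seq (x.1, g x.2 + h x.2) | x <- s]
    ([seq (x.1, g x.2) | x <- s] ++ [seq (x.1, h x.2) | x <- s]).
Proof.
elim: s => [|x s IH] /=; first exact: TensorRefl.
set G := [seq (x.1, g x.2) | x <- s] in IH *.
set K := [seq (x.1, h x.2) | x <- s] in IH *.
apply: TensorTrans (TensorCat (TensorDr phi x.1 (g x.2) (h x.2)) IH) _.
apply: tensor_cons.
by have := TensorCat (TensorComm phi [:: (x.1, h x.2)] G) (TensorRefl phi K); rewrite -!catA.
Qed.

Lemma tensor_eq_map (B' : comPzRingType) (phi' : {rmorphism A -> B'}) (g : B -> B') s t :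
  {morph g : b b' / b + b'} -> (forall a b, g (phi a * b) = phi' a * g b) ->
  tensor_eq phi s t ->
  tensor_eq phi' [seq (x.1, g x.2) | x <- s] [seq (x.1, g x.2) | x <- t].
Proof.
move=> gD gZ; elim=> {s t}.
- by move=> s; apply: TensorRefl.
- by move=> s t _; apply: TensorSym.
- by move=> s t r _ h _; apply: TensorTrans.
- by move=> s s' t t' _ h _ h'; rewrite !map_cat; apply: TensorCat.
- by move=> s t; rewrite !map_cat; apply: TensorComm.
- by move=> m m' b; apply: TensorDl.
- by move=> m b b' /=; rewrite gD; apply: TensorDr.
- by move=> a m b /=; rewrite gZ; apply: TensorZ.
- by move=> b; apply: Tensor0.
Qed.

Lemma tensor_eq_pairing (L : comPzRingType) (w : M -> B -> L) :
  (forall b, w 0 b = 0) ->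
  (forall m m' b, w (m + m') b = w m b + w m' b) ->
  (forall m b b', w m (b + b') = w m b + w m b') ->
  (forall a m b, w (a *: m) b = w m (phi a * b)) ->
  forall s t, tensor_eq phi s t -> \sum_(x <- s) w x.1 x.2 = \sum_(x <- t) w x.1 x.2.
Proof.
move=> w0 wDl wDr wZ s t; elim=> {s t} //=.
- by move=> s t r _ -> _ ->.
- by move=> s s' t t' _ e _ e'; rewrite !big_cat /= e e'.
- by move=> s t; rewrite !big_cat /= addrC.
- by move=> m m' b; rewrite !big_cons !big_nil wDl addrA.
- by move=> m b b'; rewrite !big_cons !big_nil wDr addrA.
- by move=> a m b; rewrite !big_cons !big_nil wZ.
- by move=> b; rewrite big_cons big_nil w0 addr0.
Qed.

End TensorCalculus.

Section PolynTensor.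
Variables (A : comPzRingType) (M : lmodType A).
Implicit Types n : nat.

(** The map from M (x) A[t] to M[t], with values in (A (+) M)[t]. *)
Definition tensor_poly n (s : seq (M * polyn n A)) : polyn n (trivext M) :=
  \sum_(x <- s) polyC n _ (te_mod x.1) * polyn_map n (@te_alg A M) x.2.

Lemma tensor_polyM n (v : polyn n A) (s : seq (M * polyn n A)) :
  tensor_poly [seq (x.1, v * x.2) | x <- s] = polyn_map n (@te_alg A M) v * tensor_poly s.
Proof.
rewrite /tensor_poly big_map mulr_sumr; apply: eq_bigr => x _ /=.
by rewrite rmorphM mulrCA.
Qed.

Lemma tensor_poly_coef n (s : seq (M * polyn n.+1 A)) k :
  (tensor_poly s : poly1 _) k = tensor_poly [seq (x.1, (x.2 : poly1 _) k) | x <- s].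
Proof.
rewrite /tensor_poly big_map; elim: s => [|x s IH]; first by rewrite !big_nil p1_coef0.
by rewrite !big_cons p1_coefD IH p1_const_mulE.
Qed.

(** A[t] is free over A, so that a tensor is determined by its coefficients.  For
   one variable more, a tensor is the sum of its coefficients times the powers of
   the last variable; the truncations are compared one degree at a time. *)
Lemma tensor_poly_inj n (s t : seq (M * polyn n A)) :
  tensor_poly s = tensor_poly t -> tensor_eq (polyC n A) s t.
Proof.
elim: n s t => [|n IH] s t e.
  have red (r : seq (M * A)) : tensor_eq (polyC 0 A) r [:: (\sum_(x <- r) x.2 *: x.1, 1)].
    elim: r => [|x r IH]; first by rewrite big_nil; apply: TensorSym; apply: Tensor0.
    apply: TensorTrans (tensor_cons _ IH) _; rewrite big_cons.
    apply: TensorSym; apply: TensorTrans (TensorDl _ _ _ _) _.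
    have := TensorZ (polyC 0 A) x.2 x.1 1; rewrite mulr1 /= -surjective_pairing => h.
    exact: TensorCat h (TensorRefl _ _).
  have val (r : seq (M * A)) : tensor_poly (n := 0) r = te_mod (\sum_(x <- r) x.2 *: x.1).
    rewrite /tensor_poly /=; elim: r => [|x r IH]; first by rewrite !big_nil.
    by rewrite !big_cons IH te_modD te_modZ mulrC.
  apply: TensorTrans (red s) _; apply: TensorSym; apply: TensorTrans (red t) _.
  have [->] : te_mod (\sum_(x <- t) x.2 *: x.1) = te_mod (\sum_(x <- s) x.2 *: x.1).
    by rewrite -!val e.
  exact: TensorRefl.
have coef k : tensor_eq (polyC n A)
    [seq (x.1, (x.2 : poly1 _) k) | x <- s] [seq (x.1, (x.2 : poly1 _) k) | x <- t].
  by apply: IH; rewrite -!tensor_poly_coef e.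
pose cut N (r : seq (M * polyn n.+1 A)) : seq (M * polyn n.+1 A) :=
  [seq (x.1, p1_trunc N x.2) | x <- r].
have cutE N : tensor_eq (polyC n.+1 A) (cut N s) (cut N t).
  elim: N => [|N IHN].
    have cut0 r : cut 0%N r = [seq (x.1, 0) | x <- r].
      by apply: eq_map => x; rewrite /p1_trunc big_geq.
    rewrite !cut0; apply: TensorTrans (tensor_map0 _ _) _.
    exact/TensorSym/tensor_map0.
  pose g b : polyn n.+1 A := p1_const b * p1_mono _ N.
  have cutS r : cut N.+1 r =
      [seq (x.1, p1_trunc N x.2 + g ((x.2 : poly1 _) N)) | x <- r].
    by apply: eq_map => x; rewrite /p1_trunc big_nat_recr.
  have split (r : seq (M * polyn n.+1 A)) : tensor_eq (polyC n.+1 A) (cut N.+1 r)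
      (cut N r ++ [seq (x.1, g ((x.2 : poly1 _) N)) | x <- r]).
    rewrite cutS.
    exact: (tensor_mapD (polyC n.+1 A) (p1_trunc N) (fun f : poly1 _ => g (f N)) r).
  apply: TensorTrans (split s) _.
  apply: TensorSym; apply: TensorTrans (split t) _; apply: TensorSym.
  apply: TensorCat => //.
  have gD : {morph g : b b' / b + b'} by move=> b b'; rewrite /g rmorphD mulrDl.
  have gZ a b : g (polyC n A a * b) = polyC n.+1 A a * g b by rewrite /g rmorphM mulrA.
  by have := tensor_eq_map gD gZ (coef N); rewrite -!map_comp.
have bound (r : seq (M * polyn n.+1 A)) : exists N, forall K, (N <= K)%N -> cut K r = r.
  elim: r => [|x r [N hN]]; first by exists 0%N.
  have [L hL] := p1_fin (x.2 : poly1 (polyn n A)); exists (maxn N L) => K.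
  rewrite geq_max => /andP[NK LK]; rewrite /cut /= -/(cut K r) hN // p1_truncK.
    by case: x {hL}.
  by move=> i Ki; apply: hL; apply: leq_trans Ki.
have [N hN] := bound s; have [L hL] := bound t.
by rewrite -(hN (maxn N L)) ?leq_maxl // -(hL (maxn N L)) ?leq_maxr.
Qed.

End PolynTensor.

Section FlatLocalisation.

Lemma tensor_common_denominator (C : comPzRingType) (S : mulset C) (M : Type)
    (r : seq (M * loc S)) :
  exists d (Sd : S d) (r0 : seq (M * C)), r = [seq (x.1, frac x.2 Sd) | x <- r0].
Proof.
elim: r => [|[m b] r [d [Sd [r0 ->]]]]; first by exists 1, (ms_one S), [::].
elim/locP: b => a t St.
exists (t * d), (ms_mul St Sd), ((m, a * d) :: [seq (x.1, x.2 * t) | x <- r0]).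
rewrite /= -map_comp; congr (_ :: _).
  by congr (_, _); apply/frac_eq; exists 1; [exact: ms_one | ring].
apply: eq_map => x /=; congr (_, _); apply/frac_eq.
by exists 1; [exact: ms_one | ring].
Qed.

Variables (A : comPzRingType) (n : nat).

(** Write both tensors with a common denominator d.  If their images in
   N (x) S^-1 A[t] agree, they have equal values in a ring of fractions of
   (A (+) N)[t], so that some v in S equates the numerators there.  As M[t] embeds
   in N[t], it equates them already over M, and division by v d shows that the
   tensors are equal. *)
Lemma flat_loc (S : mulset (polyn n A)) : flat (to_loc S \o polyC n A).
Proof.
move=> M N u inj s t.
have [d [Sd [r0 r0E]]] := tensor_common_denominator (s ++ t).
have [s0 sE [t0 tE]] : exists2 s0, s = [seq (x.1, frac x.2 Sd) | x <- s0] &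
    exists t0, t = [seq (x.1, frac x.2 Sd) | x <- t0].
  exists (take (size s) r0); last exists (drop (size s) r0).
    by rewrite map_take -r0E take_size_cat.
  by rewrite map_drop -r0E drop_size_cat.
pose ext := polyn_map n (@te_alg A N); pose T := ms_image ext S.
have ST c : S c -> T (ext c) by exists c.
pose w (m : N) (b : loc S) : loc T := to_loc T (polyC n _ (te_mod m)) * loc_map ST b.
move=> /(@tensor_eq_pairing _ _ _ _ _ w) e.
have {e} : \sum_(x <- [seq (u x.1, x.2) | x <- s]) w x.1 x.2
         = \sum_(x <- [seq (u x.1, x.2) | x <- t]) w x.1 x.2.
  apply: e => [b|m m' b|m b b'|a m b]; rewrite /w.
  - by rewrite te_mod0 !rmorph0 mul0r.
  - by rewrite te_modD !rmorphD mulrDl.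
  - by rewrite rmorphD mulrDr.
  - have phiE : loc_map ST (to_loc S (polyC n A a)) = to_loc T (polyC n _ (te_alg N a)).
      rewrite [LHS]loc_mapE -polyn_map_C; apply/frac_eq; exists 1; first exact: ms_one.
      by rewrite rmorph1.
    by rewrite te_modZ !rmorphM [X in _ = _ * (X * _)]phiE mulrAC mulrC.
have value (r : seq (M * polyn n A)) :
    to_loc T (ext d) * \sum_(x <- [seq (u x.1, x.2) | x <- [seq (x.1, frac x.2 Sd) | x <- r]]) w x.1 x.2
    = to_loc T (polyn_map n (te_map u) (tensor_poly r)).
  rewrite !big_map /tensor_poly !rmorph_sum mulr_sumr; apply: eq_bigr => x _ /=.
  rewrite /w [loc_map _ _]loc_mapE mulrCA to_locM_frac -rmorphM; congr (to_loc T _).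
  rewrite rmorphM polyn_map_C; congr (polyC n _ _ * _).
  symmetry; apply: polyn_map_comp => a; exact: te_map_alg.
rewrite sE tE => /(congr1 ( *%R (to_loc T (ext d)))); rewrite !value => /frac_eq[_ [v Sv ->]].
rewrite !mulr1.
have extE f : ext f = polyn_map n (te_map u) (polyn_map n (@te_alg A M) f).
  by symmetry; apply: polyn_map_comp => a; exact: te_map_alg.
rewrite extE -!rmorphM => /(polyn_map_inj (te_map_inj inj)).
rewrite -!tensor_polyM => /tensor_poly_inj.
pose g b := frac b (ms_mul Sv Sd).
have gD : {morph g : b b' / b + b'}.
  by move=> b b'; rewrite /g fracD; apply/frac_eq; exists 1; [exact: ms_one | ring].
have gZ a b : g (polyC n A a * b) = (to_loc S \o polyC n A) a * g b.
  by rewrite /g fracM; apply/frac_eq; exists 1; [exact: ms_one | ring].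
have back (r : seq (M * polyn n A)) :
    [seq (x.1, g x.2) | x <- [seq (x.1, v * x.2) | x <- r]] = [seq (x.1, frac x.2 Sd) | x <- r].
  rewrite -map_comp; apply: eq_map => x /=; congr (_, _).
  by apply/frac_eq; exists 1; [exact: ms_one | ring].
by move=> /(tensor_eq_map gD gZ); rewrite !back.
Qed.

Lemma An_localising_flat (B : comPzRingType) (phi : {rmorphism A -> B}) :
  An_localising phi n -> flat phi.
Proof.
move=> [S [e [[e' eK e'K] eE]]] M N u inj s t.
have e'D : {morph e' : x y / x + y}.
  by move=> x y; apply: (can_inj eK); rewrite rmorphD !e'K.
have e'Z a b : e' (phi a * b) = to_loc S (polyC n A a) * e' b.
  by apply: (can_inj eK); rewrite rmorphM !e'K eE.
move=> /(tensor_eq_map (phi' := to_loc S \o polyC n A) e'D e'Z).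
have swap (r : seq (M * B)) : [seq (x.1, e' x.2) | x <- [seq (u x.1, x.2) | x <- r]]
    = [seq (u x.1, x.2) | x <- [seq (x.1, e' x.2) | x <- r]].
  by rewrite -!map_comp.
rewrite !swap => /(flat_loc inj).
have eZ a b : e ((to_loc S \o polyC n A) a * b) = phi a * e b by rewrite rmorphM eE.
move=> /(tensor_eq_map (phi' := phi) (rmorphD e) eZ).
have back (r : seq (M * B)) : [seq (x.1, e x.2) | x <- [seq (x.1, e' x.2) | x <- r]] = r.
  by rewrite -map_comp -[RHS]map_id; apply: eq_map => x /=; rewrite e'K; case: x.
by rewrite !back.
Qed.

End FlatLocalisation.

(** * Stalks of a spectrum *)

Section SpecStalk.
Variables (A : comPzRingType) (p : Spec A).

Definition germ_at (a : A) : stalk p :=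
  @to_stalk (Spec A) p (op_full (Spec A)) I (const_sec (op_full (spec A)) a).

Fact germ_at_zmod : zmod_morphism germ_at.
Proof.
move=> a b; rewrite /germ_at to_stalkB; apply/to_stalk_eq/germ_eqI.
by apply: ss_ext => q Wq; apply: rmorphB.
Qed.

Fact germ_at_monoid : monoid_morphism germ_at.
Proof.
split=> [|a b]; first by rewrite /germ_at rmorph1 -to_stalk1.
rewrite /germ_at to_stalkM; apply/to_stalk_eq/germ_eqI.
by apply: ss_ext => q Wq; apply: rmorphM.
Qed.

HB.instance Definition _ := GRing.isZmodMorphism.Build A (stalk p) germ_at germ_at_zmod.
HB.instance Definition _ := GRing.isMonoidMorphism.Build A (stalk p) germ_at germ_at_monoid.

Lemma germ_atM_stalk (W : opens (Spec A)) (Wp : W p) (s : spec_sec W) a b :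
  (forall q (Wq : W q), const_sec W a q Wq * s q Wq = const_sec W b q Wq) ->
  germ_at a * @to_stalk (Spec A) p W Wp s = germ_at b.
Proof.
move=> h; rewrite /germ_at to_stalkM; apply/to_stalk_eq.
exists W; split=> //; exists (fun q Wq => conj I Wq), (fun _ _ => I).
apply: ss_ext => q Wq; apply: etrans (h q Wq).
by congr (_ * s q _); exact: Prop_irrelevance.
Qed.

Lemma germ_at_unit a : ~ sp_set p a -> is_unit (germ_at a).
Proof.
move=> pa; have [Z [Zp _] [t te]] := inv_sec (W := op_full (spec A)) I pa.
exists (@to_stalk (Spec A) p Z Zp t).
rewrite -[1](rmorph1 germ_at); apply: germ_atM_stalk => q Zq.
rewrite mulrC; have := congr1 (fun s : spec_sec Z => s q Zq) te.
by apply: etrans.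
Qed.

(** The stalk at p is the local ring of A at p. *)
Lemma frac_iso_germ_at : frac_iso (sp_compl p) germ_at.
Proof.
split=> [|a].
  elim/stalkP => U Up s.
  have [V [Vp [VU [a [g e]]]]] := ss_loc (s : spec_sec U) Up.
  have [gp _] := e p Vp; exists g => //; exists a.
  have -> : to_stalk Up s = @to_stalk (Spec A) p V Vp (ss_res VU s).
    apply/to_stalk_eq; exists V; split=> //; exists VU, (fun _ h => h).
    by apply: ss_ext => q Vq /=; congr (ss_val s _); apply: Prop_irrelevance.
  apply: germ_atM_stalk => q Vq; have [gq] := e q Vq.
  rewrite /= => ->; exact: to_locM_frac.
rewrite -[0](rmorph0 germ_at) => /spec_stalk_eq.
by rewrite !const_secE => /(frac_iso_ker (frac_iso_to_loc _))[u pu]; rewrite mulr0; exists u.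
Qed.

End SpecStalk.

(** The composite R[t] -> R(t) -> stalk x is a localisation.  It factors through the
   polynomials over the stalk at f x, which are a localisation of R[t] at constants;
   so the stalk at x is a localisation of these polynomials. *)
Lemma to_gauss_flat_mor n (R : comPzRingType) : flat_mor (Spec_mor (to_gauss n R)).
Proof.
move=> x; apply: (@An_localising_flat _ n).
set f := Spec_mor _.
pose p : Spec R := f x.
pose delta : {rmorphism polyn n R -> stalk x} := germ_at x \o to_loc (gauss_mulset n R).
have sq r : stalk_map (f := f) (x := x) (germ_at p r) = delta (polyC n R r).
  rewrite [LHS]stalk_mapE /= /germ_at; apply/to_stalk_eq.
  exists (op_full _); split=> //; exists (fun _ _ => I), (fun _ _ => I).
  apply: ss_ext => q _ /=; rewrite [LHS]loc_mapE; apply/frac_eq.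
  by exists 1; [exact: ms_one | rewrite rmorph1].
have [E [EC Ed]] := polyn_pushout (sigma := stalk_map (f := f) (x := x)) sq.
apply: (@frac_iso_localisation _ _ _ _ _ E) => //.
apply: (frac_iso_cancel Ed _ (frac_iso_polyn_map n (frac_iso_germ_at p))).
  move=> _ [s ps ->]; rewrite polyn_map_C; apply: is_unit_morph; exact: germ_at_unit.
apply: frac_iso_comp (frac_iso_to_loc _) (frac_iso_germ_at x) => s; first exact: to_loc_unit.
exact: germ_at_unit.
Qed.

(** * The morphism Spec R(t) to Spec R *)

Theorem proposition3p6 (R : comPzRingType) (n : nat) (noethR : noetherian R) :
  let f := Spec_mor (to_gauss n R) in
  [/\ strongly_An_localising f n,
      surjective_mor f,
      essentially_smooth (to_gauss n R)
    & faithfully_flat_mor f].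
Proof.
have surj : surjective_mor (Spec_mor (to_gauss n R)) := @to_gauss_spec_surjective n R.
split=> //; first exact: to_gauss_strongly_An_localising.
  exact: essentially_smooth_to_gauss.
by split=> //; exact: to_gauss_flat_mor.
Qed.
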